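(* Let $G=\langle g\rangle\cong Z_m$ be a finite cyclic group of order $m$, let $1\le a<m$, and let $\omega$ be the normalized $3$-cocycle on $G$ given by $\omega(g^i,g^j,g^k)=\zeta_m^{a i\left[\frac{j+k}{m}\right]}$ for $0\le i,j,k<m$. Then $D^\omega(G)$ is genuine if and only if $(m,2a)\nmid(m,a)$.
   Context: $k$ is an algebraically closed field of characteristic zero; cocycles take values in $k^\times$. $\zeta_m$ denotes a primitive $m$-th root of unity, $[x]$ the integer part of $x$, and $(a,b)$ the greatest common divisor. Twisted quantum double: for a finite group $G$ and a normalized $3$-cocycle $\omega$ on $G$, $D^\omega(G)$ is the quasi-Hopf algebra with underlying space $(kG)^*\otimes kG$ and $$(e(g)\otimes x)(e(h)\otimes y)=\theta_g(x,y)\,\delta_{g^x,h}\,e(g)\otimes xy,\qquad \Delta(e(g)\otimes x)=\sum_{hk=g}\gamma_x(h,k)\,e(h)\otimes x\otimes e(k)\otimes x,$$ $$\phi=\sum_{g,h,k\in G}\omega(g,h,k)^{-1}e(g)\otimes1\otimes e(h)\otimes1\otimes e(k)\otimes1,\qquad \varepsilon(e(g)\otimes x)=\delta_{g,1},$$ $$\mathcal S(e(g)\otimes x)=\theta_{g^{-1}}(x,x^{-1})^{-1}\gamma_x(g,g^{-1})^{-1}e(x^{-1}g^{-1}x)\otimes x^{-1},\quad \alpha=1,\quad \beta=\sum_{g\in G}\omega(g,g^{-1},g)e(g)\otimes1,$$ where $\{e(g)\}$ is the basis of $(kG)^*$ dual to $G$, $g^x=x^{-1}gx$, and $$\theta_g(x,y)=\frac{\omega(g,x,y)\,\omega(x,y,(xy)^{-1}gxy)}{\omega(x,x^{-1}gx,y)},\qquad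 \gamma_g(x,y)=\frac{\omega(x,y,g)\,\omega(g,g^{-1}xg,g^{-1}yg)}{\omega(x,g,g^{-1}yg)}.$$ Gauge equivalence: two quasi-Hopf algebras $H,H'$ are gauge equivalent if $H'$ is isomorphic, as a quasi-bialgebra, to the twist $H_F$ of $H$ by some invertible $F\in H\otimes H$ with $(\varepsilon\otimes\mathrm{id})(F)=1=(\mathrm{id}\otimes\varepsilon)(F)$. A quasi-Hopf algebra is called genuine if it is not gauge equivalent to any Hopf algebra. *)

(* Defs.v *)
From HB Require Import structures.
From mathcomp Require Import all_boot all_order all_algebra all_fingroup.
From mathcomp Require Import boolp ring.
Set Implicit Arguments. Unset Strict Implicit. Unset Printing Implicit Defensive.
Import GRing.Theory.

Local Notation repr := generic_quotient.repr.
Local Open Scope ring_scope.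
Local Open Scope quotient_scope.

Section Tuples.
Variables (T : Type).

Definition tuple_upd n (p : n.-tuple T) (i : 'I_n) (x : T) : n.-tuple T :=
  [tuple if j == i then x else tnth p j | j < n].

Lemma tnth_upd n (p : n.-tuple T) i x j :
  tnth (tuple_upd p i x) j = if j == i then x else tnth p j.
Proof. by rewrite tnth_mktuple. Qed.

Lemma upd_cat_l m n (p : m.-tuple T) (q : n.-tuple T) i x :
  tuple_upd [tuple of p ++ q] (lshift n i) x = [tuple of tuple_upd p i x ++ q].
Proof.
apply: eq_from_tnth => j; rewrite tnth_upd.
case: (splitP j) => l /esym jE.
  have -> : j = lshift n l by apply: val_inj; rewrite /= -jE.
  by rewrite !tnth_lshift tnth_upd eq_lshift.
have -> : j = rshift m l by apply: val_inj; rewrite /= -jE.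
by rewrite !tnth_rshift eq_rlshift.
Qed.

Lemma upd_cat_r m n (p : m.-tuple T) (q : n.-tuple T) i x :
  tuple_upd [tuple of p ++ q] (rshift m i) x = [tuple of p ++ tuple_upd q i x].
Proof.
apply: eq_from_tnth => j; rewrite tnth_upd.
case: (splitP j) => l /esym jE.
  have -> : j = lshift n l by apply: val_inj; rewrite /= -jE.
  by rewrite !tnth_lshift eq_lrshift.
have -> : j = rshift m l by apply: val_inj; rewrite /= -jE.
by rewrite !tnth_rshift tnth_upd eq_rshift.
Qed.

End Tuples.

Section TensorPower.
Variables (k : fieldType) (A : algType k).

Definition multilinear n (V : lmodType k) (f : n.-tuple A -> V) :=
  forall (p : n.-tuple A) (i : 'I_n) c x y,
    f (tuple_upd p i (c *: x + y)) = c *: f (tuple_upd p i x) + f (tuple_upd p i y).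

Definition evalsum n (V : lmodType k) (f : n.-tuple A -> V)
    (s : seq (k * n.-tuple A)) : V :=
  \sum_(cp <- s) cp.1 *: f cp.2.

(* [tpow n] is the n-fold tensor power of A over k: formal linear combinations
   of n-tuples, two of them being identified when every multilinear map takes
   the same value on both. *)
Definition teq n (s t : seq (k * n.-tuple A)) : bool :=
  `[< forall (V : lmodType k) (f : n.-tuple A -> V),
        multilinear f -> evalsum f s = evalsum f t >].

Lemma teq_refl n : reflexive (@teq n).
Proof. by move=> s; apply/asboolP. Qed.
Lemma teq_sym n : symmetric (@teq n).
Proof.
by move=> s t; apply/asboolP/asboolP => h V f fl; rewrite (h V f fl).
Qed.
Lemma teq_trans n : transitive (@teq n).
Proof.
move=> t s u /asboolP h1 /asboolP h2; apply/asboolP => V f fl.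
by rewrite (h1 V f fl) (h2 V f fl).
Qed.

Canonical teq_equiv n := EquivRel (@teq n) (@teq_refl n) (@teq_sym n) (@teq_trans n).

Definition tpow n := {eq_quot (@teq_equiv n)}.
HB.instance Definition _ n := Choice.on (tpow n).
HB.instance Definition _ n := EqQuotient.on (tpow n).

Definition tlift n (V : lmodType k) (f : n.-tuple A -> V) (t : tpow n) : V :=
  evalsum f (repr t).

Definition tsum n (s : seq (k * n.-tuple A)) : tpow n := \pi_(tpow n) s.

Lemma tsum_eqP n (s t : seq (k * n.-tuple A)) :
  (forall (V : lmodType k) (f : n.-tuple A -> V),
     multilinear f -> evalsum f s = evalsum f t) -> tsum s = tsum t.
Proof. by move=> h; apply/eqmodP; apply/asboolP. Qed.

Lemma tlift_tsum n (V : lmodType k) (f : n.-tuple A -> V) s :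
  multilinear f -> tlift f (tsum s) = evalsum f s.
Proof.
move=> fl; rewrite /tlift.
by have /eqmodP/asboolP/(_ V f fl) : repr (tsum s) = s %[mod tpow n]
  by rewrite reprK.
Qed.

Lemma tsum_repr n (t : tpow n) : tsum (repr t) = t.
Proof. exact: reprK. Qed.

Definition sscale n (c : k) (s : seq (k * n.-tuple A)) :=
  [seq (c * x.1, x.2) | x <- s].

Lemma evalsum_cat n (V : lmodType k) (f : n.-tuple A -> V) s t :
  evalsum f (s ++ t) = evalsum f s + evalsum f t.
Proof. exact: big_cat. Qed.

Lemma evalsum_scale n (V : lmodType k) (f : n.-tuple A -> V) c s :
  evalsum f (sscale c s) = c *: evalsum f s.
Proof.
by rewrite /evalsum big_map scaler_sumr; apply: eq_bigr => i _; rewrite scalerA.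
Qed.

Definition tadd n (s t : tpow n) : tpow n := tsum (repr s ++ repr t).
Definition tscale n c (t : tpow n) : tpow n := tsum (sscale c (repr t)).
Definition tzero n : tpow n := tsum [::].

Lemma tadd_tsum n (s t : seq (k * n.-tuple A)) :
  tadd (tsum s) (tsum t) = tsum (s ++ t).
Proof.
apply: tsum_eqP => V f fl; rewrite !evalsum_cat.
by rewrite -!(tlift_tsum _ fl) !tsum_repr.
Qed.

Lemma tscale_tsum n c (s : seq (k * n.-tuple A)) :
  tscale c (tsum s) = tsum (sscale c s).
Proof.
apply: tsum_eqP => V f fl; rewrite !evalsum_scale.
by rewrite -!(tlift_tsum _ fl) !tsum_repr.
Qed.

Lemma taddA n : associative (@tadd n).
Proof.
move=> s t u; rewrite -(tsum_repr s) -(tsum_repr t) -(tsum_repr u).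
by rewrite !tadd_tsum catA.
Qed.
Lemma taddC n : commutative (@tadd n).
Proof.
move=> s t; rewrite -(tsum_repr s) -(tsum_repr t) !tadd_tsum.
by apply: tsum_eqP => V f _; rewrite !evalsum_cat addrC.
Qed.
Lemma tadd0 n : left_id (tzero n) (@tadd n).
Proof. by move=> t; rewrite -(tsum_repr t) tadd_tsum. Qed.
Lemma taddN n : left_inverse (tzero n) (tscale (-1)) (@tadd n).
Proof.
move=> t; rewrite -(tsum_repr t) tscale_tsum tadd_tsum.
apply: tsum_eqP => V f _; rewrite evalsum_cat evalsum_scale scaleN1r addNr.
by rewrite /evalsum big_nil.
Qed.

HB.instance Definition _ n := GRing.isZmodule.Build (tpow n)
  (@taddA n) (@taddC n) (@tadd0 n) (@taddN n).

Lemma tscaleA n a b (v : tpow n) : tscale a (tscale b v) = tscale (a * b) v.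
Proof.
rewrite -(tsum_repr v) !tscale_tsum; apply: tsum_eqP => V f _.
by rewrite !evalsum_scale scalerA.
Qed.
Lemma tscale1 n : left_id 1 (@tscale n).
Proof.
move=> v; rewrite -(tsum_repr v) !tscale_tsum; apply: tsum_eqP => V f _.
by rewrite !evalsum_scale scale1r.
Qed.
Lemma tscaleDr n : right_distributive (@tscale n) +%R.
Proof.
move=> c u v; rewrite -(tsum_repr u) -(tsum_repr v) [_ + _]tadd_tsum.
rewrite !tscale_tsum [RHS]tadd_tsum; apply: tsum_eqP => V f _.
by rewrite !(evalsum_scale, evalsum_cat) scalerDr.
Qed.
Lemma tscaleDl n (v : tpow n) : {morph (@tscale n)^~ v : a b / a + b}.
Proof.
move=> a b; rewrite -(tsum_repr v) !tscale_tsum [RHS]tadd_tsum.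
apply: tsum_eqP => V f _.
by rewrite !(evalsum_scale, evalsum_cat) scalerDl.
Qed.

HB.instance Definition _ n := GRing.Zmodule_isLmodule.Build k (tpow n)
  (@tscaleA n) (@tscale1 n) (@tscaleDr n) (@tscaleDl n).

Definition ten n (p : n.-tuple A) : tpow n := tsum [:: (1, p)].

Lemma tsumE n (s : seq (k * n.-tuple A)) :
  tsum s = \sum_(cp <- s) cp.1 *: ten cp.2.
Proof.
elim: s => [|[c p] s IH]; first by rewrite big_nil.
rewrite big_cons -IH /= [c *: _]tscale_tsum [RHS]tadd_tsum /=.
by rewrite mulr1.
Qed.

Lemma tlift_is_linear n (V : lmodType k) (f : n.-tuple A -> V) :
  multilinear f -> linear (tlift f).
Proof.
move=> fl c s t; rewrite -(tsum_repr s) -(tsum_repr t).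
rewrite [c *: _]tscale_tsum [_ + _]tadd_tsum !tlift_tsum //.
by rewrite evalsum_cat evalsum_scale.
Qed.

Lemma tlift_ten n (V : lmodType k) (f : n.-tuple A -> V) p :
  multilinear f -> tlift f (ten p) = f p.
Proof. by move=> fl; rewrite tlift_tsum // /evalsum big_seq1 scale1r. Qed.

Lemma ten_multilinear n : multilinear (@ten n).
Proof.
move=> p i c x y.
have -> : c *: ten (tuple_upd p i x) + ten (tuple_upd p i y) =
    tsum [:: (c * 1, tuple_upd p i x); (1, tuple_upd p i y)].
  by rewrite [_ *: ten (tuple_upd p i x)]tscale_tsum [LHS]tadd_tsum.
apply: tsum_eqP => V f fl.
by rewrite /evalsum /= big_seq1 !big_cons big_nil /= mulr1 addr0 !scale1r fl.
Qed.

Lemma tpow_ind n (P : tpow n -> Prop) :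
  (forall c s p, P s -> P (c *: ten p + s)) -> P 0 -> forall t, P t.
Proof.
move=> hS h0 t; rewrite -(tsum_repr t) tsumE.
by elim: (repr t) => [|x s IH]; rewrite ?big_nil // big_cons; apply: hS.
Qed.

Lemma tpow_ext n (V : lmodType k) (f g : tpow n -> V) :
  linear f -> linear g -> (forall p, f (ten p) = g (ten p)) -> f =1 g.
Proof.
move=> fl gl h t; elim/tpow_ind: t => [c s p IH|]; first by rewrite fl gl h IH.
have fl0 (u : tpow n -> V) : linear u -> u 0 = 0.
  by move=> ul; have := ul (-1) 0 0; rewrite scaler0 addr0 scaleN1r addNr.
by rewrite !fl0.
Qed.

Definition mul_tuple n (p q : n.-tuple A) : n.-tuple A :=
  [tuple tnth p i * tnth q i | i < n].

Definition one_tuple n : n.-tuple A := [tuple 1 | i < n].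

Definition tmul n (s t : tpow n) : tpow n :=
  tlift (fun p => tlift (fun q => ten (mul_tuple p q)) t) s.

Lemma mul_upd_l n (p q : n.-tuple A) i x :
  mul_tuple (tuple_upd p i x) q = tuple_upd (mul_tuple p q) i (x * tnth q i).
Proof.
apply: eq_from_tnth => j; rewrite !tnth_mktuple.
by case: eqP => // ->.
Qed.
Lemma mul_upd_r n (p q : n.-tuple A) i x :
  mul_tuple p (tuple_upd q i x) = tuple_upd (mul_tuple p q) i (tnth p i * x).
Proof.
apply: eq_from_tnth => j; rewrite !tnth_mktuple.
by case: eqP => // ->.
Qed.

Lemma ten_mul_l n (q : n.-tuple A) :
  multilinear (fun p => ten (mul_tuple p q)).
Proof.
move=> p i c x y; rewrite !mul_upd_l mulrDl -scalerAl; exact: ten_multilinear.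
Qed.
Lemma ten_mul_r n (p : n.-tuple A) :
  multilinear (fun q => ten (mul_tuple p q)).
Proof.
move=> q i c x y; rewrite !mul_upd_r mulrDr -scalerAr; exact: ten_multilinear.
Qed.

Lemma lift_multilinear m n (V : lmodType k)
    (f : m.-tuple A -> n.-tuple A -> V) :
  (forall q, multilinear (f^~ q)) ->
  forall t, multilinear (fun p => tlift (f p) t).
Proof.
move=> fl t p i c x y; rewrite /tlift /evalsum scaler_sumr -big_split /=.
apply: eq_bigr => j _; rewrite fl scalerDr !scalerA.
by rewrite (mulrC c).
Qed.

Lemma tmul_linear_l n (t : tpow n) : linear (fun s => tmul s t).
Proof. by apply: tlift_is_linear; apply: lift_multilinear => q; apply: ten_mul_l. Qed.

Lemma lift_linear n (U V : lmodType k) (f : U -> n.-tuple A -> V) :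
  (forall p, linear (f^~ p)) -> forall s, linear (fun u => tlift (f u) s).
Proof.
move=> fl s c u v; rewrite /tlift /evalsum scaler_sumr -big_split /=.
by apply: eq_bigr => j _; rewrite fl scalerDr !scalerA (mulrC c).
Qed.

Lemma tmul_linear_r n (s : tpow n) : linear (tmul s).
Proof.
apply: (lift_linear (f := fun t p => tlift (fun q => ten (mul_tuple p q)) t)).
by move=> p; apply: tlift_is_linear; apply: ten_mul_r.
Qed.

Lemma tmul_ten n (p q : n.-tuple A) : tmul (ten p) (ten q) = ten (mul_tuple p q).
Proof.
rewrite /tmul tlift_ten; first by rewrite tlift_ten//; apply: ten_mul_r.
by apply: lift_multilinear => r; apply: ten_mul_l.
Qed.

Lemma tmulA n : associative (@tmul n).
Proof.
move=> s t u.
pose R1 := tmul_linear_r; pose L1 := tmul_linear_l.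
apply: (@tpow_ext n _ (fun s => tmul s (tmul t u))
  (fun s => tmul (tmul s t) u)) => [|c ? ?|p]; first exact: L1.
  by rewrite !(L1 n _ c).
apply: (@tpow_ext n _ (fun t => tmul (ten p) (tmul t u))
  (fun t => tmul (tmul (ten p) t) u)) => [c ? ?|c ? ?|q].
- by rewrite (L1 n _ c) (R1 n _ c).
- by rewrite (R1 n _ c) (L1 n _ c).
apply: (@tpow_ext n _ (fun u => tmul (ten p) (tmul (ten q) u))
  (fun u => tmul (tmul (ten p) (ten q)) u)) => [c ? ?||r].
- by rewrite !(R1 n _ c).
- exact: R1.
rewrite !tmul_ten; congr ten; apply: eq_from_tnth => i.
by rewrite !tnth_mktuple mulrA.
Qed.

Lemma tmul1l n : left_id (ten (one_tuple n)) (@tmul n).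
Proof.
apply: tpow_ext => [|//|p]; first exact: tmul_linear_r.
rewrite tmul_ten; congr ten; apply: eq_from_tnth => i.
by rewrite !tnth_mktuple mul1r.
Qed.

Lemma tmul1r n : right_id (ten (one_tuple n)) (@tmul n).
Proof.
apply: (@tpow_ext n _ ((@tmul n)^~ _) idfun) => [|//|p]; first exact: tmul_linear_l.
rewrite tmul_ten; congr ten; apply: eq_from_tnth => i.
by rewrite !tnth_mktuple mulr1.
Qed.

Lemma tmulDl n : left_distributive (@tmul n) +%R.
Proof.
by move=> s t u; have := tmul_linear_l u 1 s t; rewrite !scale1r.
Qed.

Lemma tmulDr n : right_distributive (@tmul n) +%R.
Proof.
by move=> s t u; have := tmul_linear_r s 1 t u; rewrite !scale1r.
Qed.

Lemma prod_multilinear n :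
  multilinear (fun p : n.-tuple A => \prod_(i < n) tnth p i).
Proof.
move=> p i c x y.
have := index_enum_uniq 'I_n; have := mem_index_enum i.
move: (index_enum _) => r ir; case/splitPr: r / ir => r1 r2.
rewrite cat_uniq /= negb_or => /and3P[_ /andP[i1 _] /andP[i2 _]].
have pr r z : i \notin r ->
    \prod_(j <- r) tnth (tuple_upd p i z) j = \prod_(j <- r) tnth p j.
  move=> ir; apply: eq_big_seq => j jr; rewrite tnth_upd.
  by case: eqP ir => // <-; rewrite jr.
rewrite !big_cat !big_cons !pr // !tnth_upd eqxx /= mulrDl mulrDr.
by rewrite -scalerAl -scalerAr.
Qed.

Lemma tone_neq0 n : ten (one_tuple n) != 0.
Proof.
apply/eqP => /(congr1 (tlift (fun p : n.-tuple A => \prod_(i < n) tnth p i))).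
rewrite tlift_ten; last exact: prod_multilinear.
rewrite big1 => [|i _]; last by rewrite tnth_mktuple.
rewrite -[0]/(tsum [::]) tlift_tsum; last exact: prod_multilinear.
by rewrite /evalsum big_nil => /eqP; rewrite oner_eq0.
Qed.

HB.instance Definition _ n := GRing.Zmodule_isNzRing.Build (tpow n)
  (@tmulA n) (@tmul1l n) (@tmul1r n) (@tmulDl n) (@tmulDr n) (@tone_neq0 n).

Lemma tscaleAl n c (s t : tpow n) : c *: (s * t) = (c *: s) * t.
Proof.
have := tmul_linear_l t c s 0; rewrite addr0 => h.
by rewrite [RHS]h -[X in _ + X]/(0 * t) mul0r addr0.
Qed.
Lemma tscaleAr n c (s t : tpow n) : c *: (s * t) = s * (c *: t).
Proof.
have := tmul_linear_r s c t 0; rewrite addr0 => h.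
by rewrite [RHS]h -[X in _ + X]/(s * 0) mulr0 addr0.
Qed.

HB.instance Definition _ n :=
  GRing.Lmodule_isLalgebra.Build k (tpow n) (@tscaleAl n).
HB.instance Definition _ n :=
  GRing.Lalgebra_isAlgebra.Build k (tpow n) (@tscaleAr n).

Lemma tenM n (p q : n.-tuple A) : ten p * ten q = ten (mul_tuple p q).
Proof. exact: tmul_ten. Qed.

Lemma ten1 n : ten (one_tuple n) = 1.
Proof. by []. Qed.

Definition tcat m n (s : tpow m) (t : tpow n) : tpow (m + n) :=
  tlift (fun p => tlift (fun q => ten [tuple of p ++ q]) t) s.

Lemma ten_cat_l m n (q : n.-tuple A) :
  multilinear (fun p : m.-tuple A => ten [tuple of p ++ q]).
Proof. by move=> p i c x y; rewrite -!upd_cat_l; exact: ten_multilinear. Qed.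
Lemma ten_cat_r m n (p : m.-tuple A) :
  multilinear (fun q : n.-tuple A => ten [tuple of p ++ q]).
Proof. by move=> q i c x y; rewrite -!upd_cat_r; exact: ten_multilinear. Qed.

Lemma tcat_linear_l m n (t : tpow n) : linear (fun s : tpow m => tcat s t).
Proof.
by apply: tlift_is_linear; apply: lift_multilinear => q; apply: ten_cat_l.
Qed.

Lemma tcat_linear_r m n (s : tpow m) : linear (@tcat m n s).
Proof.
apply: (lift_linear (f := fun t p => tlift (fun q => ten [tuple of p ++ q]) t)).
by move=> p; apply: tlift_is_linear; apply: ten_cat_r.
Qed.

Lemma tcat_ten m n (p : m.-tuple A) (q : n.-tuple A) :
  tcat (ten p) (ten q) = ten [tuple of p ++ q].
Proof.
rewrite /tcat tlift_ten; first by rewrite tlift_ten//; apply: ten_cat_r.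
by apply: lift_multilinear => r; apply: ten_cat_l.
Qed.

(* [lift2 f t] is the sum of the [f a b] over a decomposition of [t] into pure
   tensors a ox b; it is independent of the decomposition when [f] is
   bilinear, see [lift2_ten]. Likewise for [lift3]. *)
Definition lift2 (V : lmodType k) (f : A -> A -> V) : tpow 2 -> V :=
  tlift (fun p => f (tnth p 0) (tnth p 1)).

Definition lift3 (V : lmodType k) (f : A -> A -> A -> V) : tpow 3 -> V :=
  tlift (fun p => f (tnth p 0) (tnth p 1) (tnth p 2)).

End TensorPower.


Section Lifts.
Variables (k : fieldType) (A : algType k).

Lemma lift2_multilinear (V : lmodType k) (f : A -> A -> V) :
  (forall b, linear (f^~ b)) -> (forall a, linear (f a)) ->
  multilinear (fun p : 2.-tuple A => f (tnth p 0) (tnth p 1)).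
Proof.
move=> fl fr p i c x y; rewrite !tnth_upd.
by case: i => [[|[|//]] ilt]; rewrite /= ?fl ?fr.
Qed.

Lemma lift3_multilinear (V : lmodType k) (f : A -> A -> A -> V) :
  (forall b c, linear (fun a => f a b c)) ->
  (forall a c, linear (fun b => f a b c)) -> (forall a b, linear (f a b)) ->
  multilinear (fun p : 3.-tuple A => f (tnth p 0) (tnth p 1) (tnth p 2)).
Proof.
move=> fl fm fr p i c x y; rewrite !tnth_upd.
by case: i => [[|[|[|//]]] ilt]; rewrite /= ?fl ?fm ?fr.
Qed.

Lemma lift2_linear (V : lmodType k) (f : A -> A -> V) :
  (forall b, linear (f^~ b)) -> (forall a, linear (f a)) -> linear (lift2 f).
Proof. by move=> fl fr; apply: tlift_is_linear; apply: lift2_multilinear. Qed.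

Lemma lift3_linear (V : lmodType k) (f : A -> A -> A -> V) :
  (forall b c, linear (fun a => f a b c)) ->
  (forall a c, linear (fun b => f a b c)) -> (forall a b, linear (f a b)) ->
  linear (lift3 f).
Proof. by move=> ? ? ?; apply: tlift_is_linear; apply: lift3_multilinear. Qed.

Lemma lift2_ten (V : lmodType k) (f : A -> A -> V) a b :
  (forall b, linear (f^~ b)) -> (forall a, linear (f a)) ->
  lift2 f (ten [tuple a; b]) = f a b.
Proof. by move=> fl fr; rewrite /lift2 tlift_ten //; apply: lift2_multilinear. Qed.

Lemma lift3_ten (V : lmodType k) (f : A -> A -> A -> V) a b c :
  (forall b c, linear (fun a => f a b c)) ->
  (forall a c, linear (fun b => f a b c)) -> (forall a b, linear (f a b)) ->
  lift3 f (ten [tuple a; b; c]) = f a b c.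
Proof.
by move=> ? ? ?; rewrite /lift3 tlift_ten //; apply: lift3_multilinear.
Qed.

End Lifts.

Definition tmap (k : fieldType) (A B : algType k) (f : A -> B) n
    (t : tpow A n) : tpow B n :=
  tlift (fun p => ten (map_tuple f p)) t.

Section QuasiBialgebra.
Variables (k : fieldType) (A : algType k).

(* The structure maps of a quasi-bialgebra, without the axioms: twisting is
   defined on these. *)
Record qbialg := QBialg {
  comult : A -> tpow A 2;
  counit : A -> k;
  coassoc : tpow A 3
}.

Variable q : qbialg.
Local Notation Delta := (comult q).
Local Notation eps := (counit q).

(* [comult_l], [comult_r] are Delta ox id, id ox Delta; [comult_ll],
   [comult_mm], [comult_rr] apply Delta in the first, second, third factor. *)
Definition comult_l (t : tpow A 2) : tpow A 3 :=
  lift2 (fun a b => tcat (Delta a) (ten [tuple b])) t.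
Definition comult_r (t : tpow A 2) : tpow A 3 :=
  lift2 (fun a b => tcat (ten [tuple a]) (Delta b)) t.
Definition comult_ll (t : tpow A 3) : tpow A 4 :=
  lift3 (fun a b c => tcat (Delta a) (ten [tuple b; c])) t.
Definition comult_mm (t : tpow A 3) : tpow A 4 :=
  lift3 (fun a b c => tcat (ten [tuple a]) (tcat (Delta b) (ten [tuple c]))) t.
Definition comult_rr (t : tpow A 3) : tpow A 4 :=
  lift3 (fun a b c => tcat (ten [tuple a; b]) (Delta c)) t.
Definition counit_l (t : tpow A 2) : A := lift2 (fun a b => eps a *: b) t.
Definition counit_r (t : tpow A 2) : A := lift2 (fun a b => eps b *: a) t.
Definition counit_m (t : tpow A 3) : tpow A 2 :=
  lift3 (fun a b c => eps b *: ten [tuple a; c]) t.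

Record is_quasi_bialgebra : Prop := IsQuasiBialgebra {
  comult_lin : linear Delta;
  comult1 : Delta 1 = 1;
  comultM : {morph Delta : a b / a * b};
  counit_lin : scalar eps;
  counit1 : eps 1 = 1;
  counitM : {morph eps : a b / a * b};
  counitl_comult : forall a, counit_l (Delta a) = a;
  counitr_comult : forall a, counit_r (Delta a) = a;
  coassoc_inv : exists psi, coassoc q * psi = 1 /\ psi * coassoc q = 1;
  quasi_coassoc : forall a,
    comult_r (Delta a) * coassoc q = coassoc q * comult_l (Delta a);
  pentagon :
    comult_rr (coassoc q) * comult_ll (coassoc q) =
    tcat (1 : tpow A 1) (coassoc q) * comult_mm (coassoc q)
      * tcat (coassoc q) (1 : tpow A 1);
  counit_coassoc : counit_m (coassoc q) = 1
}.

(* [S] is not required to be bijective, so that every Hopf algebra is a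
   quasi-Hopf algebra with trivial associator. *)
Record is_quasi_antipode (S : A -> A) (alpha beta : A) : Prop :=
  IsQuasiAntipode {
  antipode_lin : linear S;
  antipode1 : S 1 = 1;
  antipodeM : forall a b, S (a * b) = S b * S a;
  antipode_alpha : forall a,
    lift2 (fun x y => S x * alpha * y) (Delta a) = eps a *: alpha;
  antipode_beta : forall a,
    lift2 (fun x y => x * beta * S y) (Delta a) = eps a *: beta;
  antipode_coassoc :
    lift3 (fun x y z => x * beta * S y * alpha * z) (coassoc q) = 1;
  antipode_coassocV : forall psi, coassoc q * psi = 1 -> psi * coassoc q = 1 ->
    lift3 (fun x y z => S x * alpha * y * beta * S z) psi = 1
}.

(* Twist by [F], where [Fi] is the inverse of [F]. *)
Definition twist (F Fi : tpow A 2) : qbialg := QBialg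
  (fun a => F * Delta a * Fi)
  eps
  (tcat (1 : tpow A 1) F * comult_r F * coassoc q
     * comult_l Fi * tcat Fi (1 : tpow A 1)).

End QuasiBialgebra.

(* Isomorphism of quasi-bialgebras; antipodes are not compared. *)
Definition qbialg_iso (k : fieldType) (A B : algType k)
    (p : qbialg A) (q : qbialg B) : Prop :=
  exists f : {lrmorphism A -> B},
    [/\ bijective f,
        forall a, comult q (f a) = tmap f (comult p a),
        forall a, counit q (f a) = counit p a &
        coassoc q = tmap f (coassoc p)].

Record quasi_hopf (k : fieldType) := QuasiHopf {
  qh_alg :> algType k;
  qh_struct : qbialg qh_alg;
  qh_antipode : qh_alg -> qh_alg;
  qh_alpha : qh_alg;
  qh_beta : qh_alg;
  qh_bialg_ax : is_quasi_bialgebra qh_struct;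
  qh_antipode_ax :
    is_quasi_antipode qh_struct qh_antipode qh_alpha qh_beta
}.

(* A Hopf algebra is a quasi-Hopf algebra whose associator, [alpha] and [beta]
   are trivial: the axioms above then become those of a Hopf algebra. *)
Definition is_hopf (k : fieldType) (H : quasi_hopf k) : Prop :=
  [/\ coassoc (qh_struct H) = 1, qh_alpha H = 1 & qh_beta H = 1].

Definition gauge_equivalent (k : fieldType) (H H' : quasi_hopf k) : Prop :=
  exists F Fi : tpow H 2,
    [/\ F * Fi = 1, Fi * F = 1,
        counit_l (qh_struct H) F = 1, counit_r (qh_struct H) F = 1 &
        qbialg_iso (qh_struct H') (twist (qh_struct H) F Fi)].

Definition genuine (k : fieldType) (H : quasi_hopf k) : Prop :=
  forall K : quasi_hopf k, is_hopf K -> ~ gauge_equivalent H K.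

Record cocycle3 (k : fieldType) (G : finGroupType) := Cocycle3 {
  cocycle3_fun :> G -> G -> G -> k;
  cocycle3_neq0 : forall g h l, cocycle3_fun g h l != 0;
  cocycle3_eq : forall g h l m,
    cocycle3_fun h l m * cocycle3_fun g (h * l)%g m * cocycle3_fun g h l =
    cocycle3_fun (g * h)%g l m * cocycle3_fun g h (l * m)%g;
  cocycle3_norm : forall g h,
    [/\ cocycle3_fun 1%g g h = 1, cocycle3_fun g 1%g h = 1
      & cocycle3_fun g h 1%g = 1]
}.

Section ThetaGamma.
Variables (k : fieldType) (G : finGroupType) (w : cocycle3 k G).
Implicit Types g h l x y z : G.

(* The conjugate [x ^ g] is g^-1 x g. *)
Definition theta g x y : k :=
  w g x y * w x y (g ^ (x * y))%g / w x (g ^ x)%g y.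

Definition gamma g x y : k :=
  w x y g * w g (x ^ g)%g (y ^ g)%g / w x g (y ^ g)%g.

Lemma cocycle3_1l g h : w 1%g g h = 1. Proof. by case: (cocycle3_norm w g h). Qed.
Lemma cocycle3_1m g h : w g 1%g h = 1. Proof. by case: (cocycle3_norm w g h). Qed.
Lemma cocycle3_1r g h : w g h 1%g = 1. Proof. by case: (cocycle3_norm w g h). Qed.

Let w0 g h l : w g h l != 0. Proof. exact: cocycle3_neq0. Qed.

Lemma theta_neq0 g x y : theta g x y != 0.
Proof. by rewrite /theta /gamma !mulf_neq0 ?invr_neq0 ?w0. Qed.
Lemma gamma_neq0 g x y : gamma g x y != 0.
Proof. by rewrite /theta /gamma !mulf_neq0 ?invr_neq0 ?w0. Qed.

Lemma theta_1r g x : theta g x 1%g = 1.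
Proof. by rewrite /theta !(cocycle3_1l, cocycle3_1m, cocycle3_1r) invr1 !mulr1. Qed.
Lemma theta_1m g x : theta g 1%g x = 1.
Proof. by rewrite /theta !(cocycle3_1l, cocycle3_1m, cocycle3_1r) invr1 !mulr1. Qed.
Lemma theta_1l x y : theta 1%g x y = 1.
Proof. by rewrite /theta !conj1g !(cocycle3_1l, cocycle3_1m, cocycle3_1r) invr1 !mulr1. Qed.
Lemma gamma_1 x y : gamma 1%g x y = 1.
Proof. by rewrite /gamma !(cocycle3_1l, cocycle3_1m, cocycle3_1r) invr1 !mulr1. Qed.
Lemma gamma_1l g y : gamma g 1%g y = 1.
Proof. by rewrite /gamma !conj1g !(cocycle3_1l, cocycle3_1m, cocycle3_1r) invr1 !mulr1. Qed.
Lemma gamma_1r g x : gamma g x 1%g = 1.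
Proof. by rewrite /gamma !conj1g !(cocycle3_1l, cocycle3_1m, cocycle3_1r) invr1 !mulr1. Qed.

Lemma thetaM g x y z :
  theta g x y * theta g (x * y)%g z = theta (g ^ x)%g y z * theta g x (y * z)%g.
Proof.
rewrite /theta.
set u := (g ^ x)%g; set v := (g ^ (x * y))%g; set t := (g ^ (x * y * z))%g.
have -> : (u ^ y)%g = v by rewrite -conjgM.
have -> : (u ^ (y * z))%g = t by rewrite -conjgM mulgA.
rewrite mulgA -/t.
have gx : (g * x = x * u)%g by rewrite -conjgC.
have uy : (u * y = y * v)%g by rewrite conjgC -conjgM.
have vz : (v * z = z * t)%g by rewrite conjgC -conjgM.
have E1 := cocycle3_eq w g x y z.
have E2 := cocycle3_eq w x u y z.
have E3 := cocycle3_eq w x y v z.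
have E4 := cocycle3_eq w x y z t.
rewrite gx in E1; rewrite uy in E2; rewrite vz in E3.
move: E1 E2 E3 E4.
move: (w0 x y z) (w0 g (x * y)%g z) (w0 g x y) (w0 (x * u)%g y z) (w0 g x (y * z)%g).
move: (w0 u y z) (w0 x (y * v)%g z) (w0 x u y) (w0 x u (y * z)%g).
move: (w0 y v z) (w0 x y v) (w0 (x * y)%g v z) (w0 x y (z * t)%g).
move: (w0 y z t) (w0 x (y * z)%g t) (w0 (x * y)%g z t).
move: (w x y z) (w g (x * y)%g z) (w g x y) (w (x * u)%g y z) (w g x (y * z)%g)
 (w u y z) (w x (y * v)%g z) (w x u y) (w x u (y * z)%g)
 (w y v z) (w x y v) (w (x * y)%g v z) (w x y (z * t)%g)
 (w y z t) (w x (y * z)%g t) (w (x * y)%g z t).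
move=> a1 a2 a3 a4 a5 a6 a7 a8 a9 a10 a11 a12 a13 a14 a15 a16.
move=> n14 n15 n16 n10 n11 n12 n13 n6 n7 n8 n9 n1 n2 n3 n4 n5.
move=> E1 E2 E3 E4.
have -> : a3 = a4 * a5 / (a1 * a2) by rewrite -E1; field; rewrite n1 n2.
have -> : a9 = a6 * a7 * a8 / a4 by rewrite E2; field.
have -> : a12 = a10 * a7 * a11 / a13 by rewrite E3; field.
have -> : a1 = a16 * a13 / (a14 * a15) by rewrite -E4; field; rewrite n14 n15.
by field; rewrite ?n1 ?n2 ?n3 ?n4 ?n5 ?n6 ?n7 ?n8 ?n9 ?n10 ?n11 ?n13 ?n14 ?n15 ?n16.
Qed.


Definition cocycle3_dcob g h l m : k :=
  w h l m * w g (h * l)%g m * w g h l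
  / (w (g * h)%g l m * w g h (l * m)%g).

Lemma cocycle3_dcob1 g h l m : cocycle3_dcob g h l m = 1.
Proof. by rewrite /cocycle3_dcob cocycle3_eq divff // mulf_neq0. Qed.

Lemma gammaM g h l x :
  gamma x g (h * l)%g * gamma x h l * w g h l =
  gamma x (g * h)%g l * gamma x g h * w (g ^ x)%g (h ^ x)%g (l ^ x)%g.
Proof.
rewrite /gamma (conjMg g h) (conjMg h l).
set g' := (g ^ x)%g; set h' := (h ^ x)%g; set l' := (l ^ x)%g.
have gx : (g * x = x * g')%g by rewrite -conjgC.
have hx : (h * x = x * h')%g by rewrite -conjgC.
have lx : (l * x = x * l')%g by rewrite -conjgC.
transitivity (w (g * h)%g l x * w x (g' * h')%g l' / w (g * h)%g x l' *
   (w g h x * w x g' h' / w g x h') * w g' h' l' *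
   (cocycle3_dcob g h l x / cocycle3_dcob g h x l' * cocycle3_dcob g x h' l' / cocycle3_dcob x g' h' l')).
  rewrite /cocycle3_dcob gx hx lx; field.
  by rewrite !w0.
by rewrite !cocycle3_dcob1 !divr1 !mulr1.
Qed.

Lemma theta_gamma g h x y :
  theta (g * h)%g x y * gamma (x * y)%g g h =
  theta g x y * theta h x y * gamma x g h * gamma y (g ^ x)%g (h ^ x)%g.
Proof.
rewrite /gamma /theta !(conjMg g h) -!conjgM.
have := conjgM g x y; have := conjgM h x y.
set g' := (g ^ x)%g; set h' := (h ^ x)%g.
set g2 := (g ^ (x * y))%g; set h2 := (h ^ (x * y))%g => hh gg.
have gx : (g * x = x * g')%g by rewrite -conjgC.
have hx : (h * x = x * h')%g by rewrite -conjgC.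
have gy : (g' * y = y * g2)%g by rewrite gg -conjgC.
have hy : (h' * y = y * h2)%g by rewrite hh -conjgC.
set T := RHS.
transitivity (T *
   (cocycle3_dcob g x h' y * cocycle3_dcob x g' y h2 /
   (cocycle3_dcob g h x y * cocycle3_dcob g x y h2 * cocycle3_dcob x g' h' y * cocycle3_dcob x y g2 h2))).
  rewrite /T /cocycle3_dcob gx hx gy hy; field.
  by rewrite !w0.
by rewrite !cocycle3_dcob1 !mulr1 divr1 mulr1.
Qed.

Lemma theta_inv g x : theta (g ^ x)%g x^-1%g x = theta g x x^-1%g.
Proof.
have := thetaM g x x^-1%g x.
by rewrite mulgV mulVg theta_1m theta_1r !mulr1.
Qed.

Lemma gamma_inv g x :
  gamma x g g^-1%g * w (g ^ x)%g (g ^ x)^-1%g (g ^ x)%g =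
  w g g^-1%g g * gamma x g^-1%g g.
Proof.
have := gammaM g g^-1%g g x.
rewrite mulVg mulgV gamma_1l gamma_1r conjVg !mul1r => <-.
by rewrite mulrC.
Qed.

Lemma cocycle3_inv g : w g g^-1%g g * w g^-1%g g g^-1%g = 1.
Proof.
have := cocycle3_eq w g g^-1%g g g^-1%g.
by rewrite mulVg mulgV !(cocycle3_1l, cocycle3_1m, cocycle3_1r) !mulr1 mulrC.
Qed.

Definition antipode_coef g x : k := (theta g^-1%g x x^-1%g)^-1 * (gamma x g g^-1%g)^-1.

Lemma antipode_coefM g x y :
  theta g x y * antipode_coef g (x * y)%g =
  antipode_coef (g ^ x)%g y * antipode_coef g x
    * theta (g^-1 ^ (x * y))%g y^-1%g x^-1%g.
Proof.
rewrite /antipode_coef invMg -conjVg.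
have := theta_gamma g g^-1%g x y; rewrite mulgV theta_1l mul1r => ->.
have := thetaM g^-1%g (x * y)%g y^-1%g x^-1%g.
rewrite mulgK => E.
have := thetaM g^-1%g x y y^-1%g.
rewrite mulgV theta_1r mulr1 => E2.
have -> : theta g^-1%g (x * y)%g (y^-1 * x^-1)%g =
   theta (g^-1 ^ x)%g y y^-1%g / theta g^-1%g x y * theta g^-1%g x x^-1%g
   / theta (g^-1 ^ (x * y))%g y^-1%g x^-1%g.
  rewrite -E2 (mulrC (theta _ x y)) mulfK ?theta_neq0 // E.
  by rewrite [X in X / _]mulrC mulfK // theta_neq0.
by field; rewrite !theta_neq0 !gamma_neq0.
Qed.

End ThetaGamma.

Section LinearSums.
Variables (k : fieldType) (U V : lmodType k) (f : U -> V).
Hypothesis fl : linear f.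

Lemma plin0 : f 0 = 0.
Proof. by have := fl (-1) 0 0; rewrite scaler0 addr0 scaleN1r addNr. Qed.
Lemma plinZ c u : f (c *: u) = c *: f u.
Proof. by have := fl c u 0; rewrite plin0 !addr0. Qed.
Lemma plinD u v : f (u + v) = f u + f v.
Proof. by have := fl 1 u v; rewrite !scale1r. Qed.
Lemma plin_sum (I : Type) (r : seq I) (P : pred I) (F : I -> U) :
  f (\sum_(i <- r | P i) F i) = \sum_(i <- r | P i) f (F i).
Proof. exact: (big_morph f plinD plin0). Qed.

End LinearSums.

Section TwistedDouble.
Variables (k : fieldType) (G : finGroupType) (w : cocycle3 k G).
Implicit Types g h l x y z : G.

(* The algebra D^w(G): an element is given by its coordinates in the basis
   e(g) ox x, indexed by the pairs (g, x). *)
Definition tqd of cocycle3 k G := {ffun G * G -> k^o}.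
Local Notation D := (tqd w).
HB.instance Definition _ := GRing.Lmodule.on D.

(* [tqdE g x] is the basis element e(g) ox x. *)
Definition tqdE g x : D := [ffun p => (p == (g, x))%:R].

Definition tqd_mulE (p q : G * G) : D :=
  if (p.1 ^ p.2)%g == q.1 then
    theta w p.1 p.2 q.2 *: tqdE p.1 (p.2 * q.2)%g
  else 0.

Definition tqd_mul (u v : D) : D :=
  \sum_p \sum_q (u p * v q) *: tqd_mulE p q.

Definition tqd1 : D := \sum_g tqdE g 1%g.

Lemma tqd_decomp (u : D) : u = \sum_p u p *: tqdE p.1 p.2.
Proof.
apply/ffunP => q; rewrite sum_ffunE (bigD1 q) //= big1 ?addr0 => [|p pq].
  by rewrite !ffunE -surjective_pairing eqxx; exact/esym/mulr1.
rewrite !ffunE -surjective_pairing eq_sym (negPf pq); exact: mulr0.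
Qed.

Lemma tqd_ext (V : lmodType k) (f f' : D -> V) :
  linear f -> linear f' -> (forall g x, f (tqdE g x) = f' (tqdE g x)) ->
  f =1 f'.
Proof.
move=> fl fl' h u; rewrite (tqd_decomp u) !plin_sum //.
by apply: eq_bigr => p _; rewrite !plinZ // h.
Qed.

Lemma tqd_mul_lin_l v : linear (tqd_mul^~ v).
Proof.
move=> c u u'; rewrite /tqd_mul scaler_sumr -big_split; apply: eq_bigr => p _.
rewrite scaler_sumr -big_split; apply: eq_bigr => q _ /=.
by rewrite !ffunE mulrDl scalerDl scalerA mulrA.
Qed.

Lemma tqd_mul_lin_r u : linear (tqd_mul u).
Proof.
move=> c v v'; rewrite /tqd_mul scaler_sumr -big_split; apply: eq_bigr => p _.
rewrite scaler_sumr -big_split; apply: eq_bigr => q _ /=.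
by rewrite !ffunE mulrDr scalerDl scalerA mulrCA.
Qed.

Lemma tqd_mul_EE g x h y :
  tqd_mul (tqdE g x) (tqdE h y) =
  if (g ^ x)%g == h then theta w g x y *: tqdE g (x * y)%g else 0.
Proof.
rewrite /tqd_mul (bigD1 (g, x)) //= [X in _ + X]big1 ?addr0 => [|p pg].
  rewrite (bigD1 (h, y)) //= [X in _ + X]big1 ?addr0 => [|q qg].
    by rewrite !ffunE !eqxx mulr1 scale1r.
  by rewrite !ffunE (negPf qg) mulr0 scale0r.
by apply: big1 => q _; rewrite !ffunE (negPf pg) mul0r scale0r.
Qed.

Lemma tqd_mulA : associative tqd_mul.
Proof.
move=> s t u; pose R1 := tqd_mul_lin_r; pose L1 := tqd_mul_lin_l.
apply: (tqd_ext (f := fun s => tqd_mul s (tqd_mul t u))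
  (f' := fun s => tqd_mul (tqd_mul s t) u)) => [|c ? ?|g x]; first exact: L1.
  by rewrite !(L1 _ c).
apply: (tqd_ext (f := fun t => tqd_mul (tqdE g x) (tqd_mul t u))
  (f' := fun t => tqd_mul (tqd_mul (tqdE g x) t) u)) => [c ? ?|c ? ?|h y].
- by rewrite (L1 _ c) (R1 _ c).
- by rewrite (R1 _ c) (L1 _ c).
apply: (tqd_ext (f := fun u => tqd_mul (tqdE g x) (tqd_mul (tqdE h y) u))
  (f' := fun u => tqd_mul (tqd_mul (tqdE g x) (tqdE h y)) u))
  => [c ? ?||l z].
- by rewrite !(R1 _ c).
- exact: R1.
rewrite !tqd_mul_EE.
case: ((h ^ y)%g =P l) => [hl|hl]; case: ((g ^ x)%g =P h) => [gh|gh].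
- rewrite (plinZ (R1 _)) (plinZ (L1 _)) !tqd_mul_EE conjgM gh hl !eqxx !scalerA.
  by rewrite mulgA [RHS]/(_ *: _) thetaM gh mulrC.
- by rewrite (plinZ (R1 _)) (plin0 (L1 _)) tqd_mul_EE; case: eqP => // _; rewrite scaler0.
- rewrite (plin0 (R1 _)) (plinZ (L1 _)) tqd_mul_EE conjgM gh.
  by case: eqP => [E|_]; [case: hl | rewrite scaler0].
- by rewrite (plin0 (R1 _)) (plin0 (L1 _)).
Qed.

Lemma tqd_mul1l : left_id tqd1 tqd_mul.
Proof.
apply: tqd_ext => [|//|g x]; first exact: tqd_mul_lin_r.
rewrite /tqd1 (plin_sum (tqd_mul_lin_l _)) (bigD1 g) //= big1 ?addr0 => [|h hg].
  by rewrite tqd_mul_EE conjg1 eqxx theta_1m mul1g scale1r.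
by rewrite tqd_mul_EE conjg1 (negPf hg).
Qed.

Lemma tqd_mul1r : right_id tqd1 tqd_mul.
Proof.
apply: (tqd_ext (f := tqd_mul^~ tqd1) (f' := idfun)) => [|//|g x];
  first exact: tqd_mul_lin_l.
rewrite /tqd1 (plin_sum (tqd_mul_lin_r _)) (bigD1 (g ^ x)%g) //= big1 ?addr0
  => [|h hg].
  by rewrite tqd_mul_EE eqxx theta_1r mulg1 scale1r.
by rewrite tqd_mul_EE eq_sym (negPf hg).
Qed.

Lemma tqd_mulDl : left_distributive tqd_mul +%R.
Proof. by move=> u v s; rewrite (plinD (tqd_mul_lin_l s)). Qed.
Lemma tqd_mulDr : right_distributive tqd_mul +%R.
Proof. by move=> u v s; rewrite (plinD (tqd_mul_lin_r u)). Qed.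

Lemma tqd1_neq0 : tqd1 != 0.
Proof.
apply/eqP => /ffunP /(_ (1%g, 1%g)); rewrite sum_ffunE (bigD1 1%g) //=.
rewrite big1 => [|g g1]; last by rewrite !ffunE xpair_eqE eq_sym (negPf g1).
by rewrite !ffunE eqxx addr0 => /eqP; rewrite oner_eq0.
Qed.

HB.instance Definition _ := GRing.Zmodule_isNzRing.Build D
  tqd_mulA tqd_mul1l tqd_mul1r tqd_mulDl tqd_mulDr tqd1_neq0.

Lemma tqd_scaleAl c (u v : D) : c *: (u * v) = (c *: u) * v.
Proof. by rewrite [RHS](plinZ (tqd_mul_lin_l v)). Qed.
Lemma tqd_scaleAr c (u v : D) : c *: (u * v) = u * (c *: v).
Proof. by rewrite [RHS](plinZ (tqd_mul_lin_r u)). Qed.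

HB.instance Definition _ := GRing.Lmodule_isLalgebra.Build k D tqd_scaleAl.
HB.instance Definition _ := GRing.Lalgebra_isAlgebra.Build k D tqd_scaleAr.

Lemma tqdE_M g x h y :
  tqdE g x * tqdE h y =
  if (g ^ x)%g == h then theta w g x y *: tqdE g (x * y)%g else 0.
Proof. exact: tqd_mul_EE. Qed.

End TwistedDouble.

Section TensorLinearity.
Variables (k : fieldType) (A : algType k).

Lemma plin_comp (U V W : lmodType k) (f : V -> W) (g : U -> V) :
  linear f -> linear g -> linear (fun x => f (g x)).
Proof. by move=> fl gl c x y; rewrite gl fl. Qed.

Lemma plin_ten n (p : n.-tuple A) i : linear (fun a => ten (tuple_upd p i a)).
Proof. by move=> c x y; apply: ten_multilinear. Qed.

Lemma ten1_lin : linear (fun a : A => ten [tuple a]).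
Proof.
suff E a : [tuple a] = tuple_upd [tuple a] 0 a :> 1.-tuple A.
  move=> c x y; rewrite [in RHS](E x) [in RHS](E y) E.
  have U z t : tuple_upd [tuple z] 0 t = tuple_upd [tuple 0] 0 t :> 1.-tuple A.
    by apply: eq_from_tnth => -[[|//] ?]; rewrite !tnth_upd.
  by rewrite (U (c *: x + y)) (U x) (U y) plin_ten.
by apply: eq_from_tnth => -[[|//] ?]; rewrite !tnth_upd.
Qed.

Lemma tcat_tenE m n (p : m.-tuple A) (q : n.-tuple A) (r : (m + n).-tuple A) :
  tval r = p ++ q -> ten r = tcat (ten p) (ten q).
Proof. by move=> h; rewrite tcat_ten; congr ten; apply: val_inj. Qed.

Lemma ten2E (a b : A) : ten [tuple a; b] = tcat (ten [tuple a]) (ten [tuple b]).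
Proof. exact: (@tcat_tenE 1 1). Qed.
Lemma ten3E (a b c : A) :
  ten [tuple a; b; c] = tcat (ten [tuple a]) (ten [tuple b; c]).
Proof. exact: (@tcat_tenE 1 2). Qed.
Lemma ten4E (a b c d : A) :
  ten [tuple a; b; c; d] = tcat (ten [tuple a; b]) (ten [tuple c; d]).
Proof. exact: (@tcat_tenE 2 2). Qed.

Lemma ten2_lin1 b : linear (fun a : A => ten [tuple a; b]).
Proof. by move=> c x y; rewrite !ten2E ten1_lin tcat_linear_l. Qed.
Lemma ten2_lin2 a : linear (fun b : A => ten [tuple a; b]).
Proof. by move=> c x y; rewrite !ten2E ten1_lin tcat_linear_r. Qed.
Lemma ten3_lin1 b d : linear (fun a : A => ten [tuple a; b; d]).
Proof. by move=> c x y; rewrite !ten3E ten1_lin tcat_linear_l. Qed.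
Lemma ten3_lin2 a d : linear (fun b : A => ten [tuple a; b; d]).
Proof. by move=> c x y; rewrite !ten3E ten2_lin1 tcat_linear_r. Qed.
Lemma ten3_lin3 a b : linear (fun d : A => ten [tuple a; b; d]).
Proof. by move=> c x y; rewrite !ten3E ten2_lin2 tcat_linear_r. Qed.
Lemma ten4_lin1 b d e : linear (fun a : A => ten [tuple a; b; d; e]).
Proof. by move=> c x y; rewrite !ten4E ten2_lin1 tcat_linear_l. Qed.
Lemma ten4_lin2 a d e : linear (fun b : A => ten [tuple a; b; d; e]).
Proof. by move=> c x y; rewrite !ten4E ten2_lin2 tcat_linear_l. Qed.
Lemma ten4_lin3 a b e : linear (fun d : A => ten [tuple a; b; d; e]).
Proof. by move=> c x y; rewrite !ten4E ten2_lin1 tcat_linear_r. Qed.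
Lemma ten4_lin4 a b d : linear (fun e : A => ten [tuple a; b; d; e]).
Proof. by move=> c x y; rewrite !ten4E ten2_lin2 tcat_linear_r. Qed.

Lemma ten2M (a b c d : A) :
  ten [tuple a; b] * ten [tuple c; d] = ten [tuple a * c; b * d].
Proof.
rewrite tenM; congr ten; apply: eq_from_tnth.
by case=> [[|[|//]] ?]; rewrite tnth_mktuple.
Qed.
Lemma ten3M (a b c a' b' c' : A) :
  ten [tuple a; b; c] * ten [tuple a'; b'; c']
  = ten [tuple a * a'; b * b'; c * c'].
Proof.
rewrite tenM; congr ten; apply: eq_from_tnth.
by case=> [[|[|[|//]]] ?]; rewrite tnth_mktuple.
Qed.
Lemma ten4M (a b c d a' b' c' d' : A) :
  ten [tuple a; b; c; d] * ten [tuple a'; b'; c'; d']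
  = ten [tuple a * a'; b * b'; c * c'; d * d'].
Proof.
rewrite tenM; congr ten; apply: eq_from_tnth.
by case=> [[|[|[|[|//]]]] ?]; rewrite tnth_mktuple.
Qed.

Lemma ten1_1 : ten [tuple (1 : A)] = 1.
Proof.
rewrite -ten1; congr ten; apply: eq_from_tnth.
by case=> [[|//] ?]; rewrite tnth_mktuple.
Qed.
Lemma ten2_1 : ten [tuple (1 : A); 1] = 1.
Proof.
rewrite -ten1; congr ten; apply: eq_from_tnth.
by case=> [[|[|//]] ?]; rewrite tnth_mktuple.
Qed.
Lemma ten3_1 : ten [tuple (1 : A); 1; 1] = 1.
Proof.
rewrite -ten1; congr ten; apply: eq_from_tnth.
by case=> [[|[|[|//]]] ?]; rewrite tnth_mktuple.
Qed.

Variable q : qbialg A.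
Hypothesis comult_lin : linear (comult q).
Hypothesis counit_lin : scalar (counit q).
Let D := comult q.
Let e := counit q.

Let dl := comult_lin.

Lemma comult_l_lin : linear (comult_l q).
Proof.
apply: lift2_linear => [b|a].
  exact: (plin_comp (@tcat_linear_l k A 2 1 _) dl).
exact: (plin_comp (@tcat_linear_r k A 2 1 _) ten1_lin).
Qed.
Lemma comult_l_ten a b :
  comult_l q (ten [tuple a; b]) = tcat (D a) (ten [tuple b]).
Proof.
apply: (lift2_ten (f := fun a b => tcat (D a) (ten [tuple b]))) => [?|?].
  exact: (plin_comp (@tcat_linear_l k A 2 1 _) dl).
exact: (plin_comp (@tcat_linear_r k A 2 1 _) ten1_lin).
Qed.

Lemma comult_r_lin : linear (comult_r q).
Proof.
apply: lift2_linear => [b|a].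
  exact: (plin_comp (@tcat_linear_l k A 1 2 _) ten1_lin).
exact: (plin_comp (@tcat_linear_r k A 1 2 _) dl).
Qed.
Lemma comult_r_ten a b :
  comult_r q (ten [tuple a; b]) = tcat (ten [tuple a]) (D b).
Proof.
apply: (lift2_ten (f := fun a b => tcat (ten [tuple a]) (D b))) => [?|?].
  exact: (plin_comp (@tcat_linear_l k A 1 2 _) ten1_lin).
exact: (plin_comp (@tcat_linear_r k A 1 2 _) dl).
Qed.

Lemma comult_ll_lin : linear (comult_ll q).
Proof.
apply: lift3_linear => [? ?|? ?|? ?].
- exact: (plin_comp (@tcat_linear_l k A 2 2 _) dl).
- exact: (plin_comp (@tcat_linear_r k A 2 2 _) (ten2_lin1 _)).
- exact: (plin_comp (@tcat_linear_r k A 2 2 _) (ten2_lin2 _)).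
Qed.
Lemma comult_ll_ten a b c :
  comult_ll q (ten [tuple a; b; c]) = tcat (D a) (ten [tuple b; c]).
Proof.
apply: (lift3_ten (f := fun a b c => tcat (D a) (ten [tuple b; c]))) => [? ?|? ?|? ?].
- exact: (plin_comp (@tcat_linear_l k A 2 2 _) dl).
- exact: (plin_comp (@tcat_linear_r k A 2 2 _) (ten2_lin1 _)).
- exact: (plin_comp (@tcat_linear_r k A 2 2 _) (ten2_lin2 _)).
Qed.

Lemma comult_rr_lin : linear (comult_rr q).
Proof.
apply: lift3_linear => [? ?|? ?|? ?].
- exact: (plin_comp (@tcat_linear_l k A 2 2 _) (ten2_lin1 _)).
- exact: (plin_comp (@tcat_linear_l k A 2 2 _) (ten2_lin2 _)).
- exact: (plin_comp (@tcat_linear_r k A 2 2 _) dl).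
Qed.
Lemma comult_rr_ten a b c :
  comult_rr q (ten [tuple a; b; c]) = tcat (ten [tuple a; b]) (D c).
Proof.
apply: (lift3_ten (f := fun a b c => tcat (ten [tuple a; b]) (D c))) => [? ?|? ?|? ?].
- exact: (plin_comp (@tcat_linear_l k A 2 2 _) (ten2_lin1 _)).
- exact: (plin_comp (@tcat_linear_l k A 2 2 _) (ten2_lin2 _)).
- exact: (plin_comp (@tcat_linear_r k A 2 2 _) dl).
Qed.

Let mm_lin2 a c :
  linear (fun b => tcat (ten [tuple a]) (tcat (D b) (ten [tuple c]))).
Proof.
apply: (plin_comp (@tcat_linear_r k A 1 3 _)).
exact: (plin_comp (@tcat_linear_l k A 2 1 _) dl).
Qed.
Let mm_lin3 a b :
  linear (fun c => tcat (ten [tuple a]) (tcat (D b) (ten [tuple c]))).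
Proof.
apply: (plin_comp (@tcat_linear_r k A 1 3 _)).
exact: (plin_comp (@tcat_linear_r k A 2 1 _) ten1_lin).
Qed.

Lemma comult_mm_lin : linear (comult_mm q).
Proof.
apply: lift3_linear => [? ?|? ?|? ?].
- exact: (plin_comp (@tcat_linear_l k A 1 3 _) ten1_lin).
- exact: mm_lin2.
- exact: mm_lin3.
Qed.
Lemma comult_mm_ten a b c :
  comult_mm q (ten [tuple a; b; c]) =
  tcat (ten [tuple a]) (tcat (D b) (ten [tuple c])).
Proof.
apply: (lift3_ten (f := fun a b c => tcat (ten [tuple a]) (tcat (D b) (ten [tuple c])))) => [? ?|? ?|? ?].
- exact: (plin_comp (@tcat_linear_l k A 1 3 _) ten1_lin).
- exact: mm_lin2.
- exact: mm_lin3.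
Qed.

Let scal_lin1 (V : lmodType k) (v : V) : linear (fun a => e a *: v).
Proof. by move=> c x y; rewrite /e counit_lin scalerDl scalerA. Qed.
Let scal_lin2 (V : lmodType k) (f : A -> V) a :
  linear f -> linear (fun b => e a *: f b).
Proof. by move=> fl c x y; rewrite fl scalerDr !scalerA mulrC. Qed.

Lemma counit_l_lin : linear (counit_l q).
Proof.
by apply: lift2_linear => ?; [apply: scal_lin1 | apply: (scal_lin2 (f := idfun))].
Qed.
Lemma counit_l_ten a b : counit_l q (ten [tuple a; b]) = e a *: b.
Proof.
apply: (lift2_ten (f := fun a b => e a *: b)) => ?; first exact: scal_lin1.
exact: (scal_lin2 (f := idfun)).
Qed.
Lemma counit_r_lin : linear (counit_r q).
Proof.
by apply: lift2_linear => ?; [apply: (scal_lin2 (f := idfun)) | apply: scal_lin1].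
Qed.
Lemma counit_r_ten a b : counit_r q (ten [tuple a; b]) = e b *: a.
Proof.
apply: (lift2_ten (f := fun a b => e b *: a)) => ?; last exact: scal_lin1.
exact: (scal_lin2 (f := idfun)).
Qed.
Lemma counit_m_lin : linear (counit_m q).
Proof.
apply: lift3_linear => [? ?|? ?|? ?].
- by apply: scal_lin2; apply: ten2_lin1.
- exact: scal_lin1.
- by apply: scal_lin2; apply: ten2_lin2.
Qed.
Lemma counit_m_ten a b c :
  counit_m q (ten [tuple a; b; c]) = e b *: ten [tuple a; c].
Proof.
apply: (lift3_ten (f := fun a b c => e b *: ten [tuple a; c])) => [? ?|? ?|? ?].
- by apply: scal_lin2; apply: ten2_lin1.
- exact: scal_lin1.
- by apply: scal_lin2; apply: ten2_lin2.
Qed.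

End TensorLinearity.

Section BasisProduct.
Variables (k : fieldType) (R : algType k) (G : finGroupType) (P : finType).
Variables (B : P -> G -> R) (cj : P -> G -> P) (th : P -> G -> G -> k).
Hypothesis B_M : forall p x q y,
  B p x * B q y = if cj p x == q then th p x y *: B p (x * y)%g else 0.

Lemma basis_mul c d x y :
  (\sum_p c p *: B p x) * (\sum_q d q *: B q y) =
  \sum_p (c p * d (cj p x) * th p x y) *: B p (x * y)%g.
Proof.
rewrite mulr_suml; apply: eq_bigr => p _; rewrite mulr_sumr.
rewrite (bigD1 (cj p x)) //= big1 ?addr0 => [|q qp].
  by rewrite -scalerAl -scalerAr B_M eqxx !scalerA.
by rewrite -scalerAl -scalerAr B_M eq_sym (negPf qp) !scaler0.
Qed.

End BasisProduct.

Section TwistedDoubleStructure.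
Variables (k : fieldType) (G : finGroupType) (w : cocycle3 k G).
Implicit Types g h l x y z : G.
Local Notation D := (tqd w).
Local Notation E := (tqdE w).

Definition tqd_comultE g x : tpow D 2 :=
  \sum_h \sum_(l | (h * l)%g == g) gamma w x h l *: ten [tuple E h x; E l x].

Definition tqd_comult (u : D) : tpow D 2 :=
  \sum_p (u p : k) *: tqd_comultE p.1 p.2.

Definition tqd_counit (u : D) : k := \sum_p u p * (p.1 == 1%g)%:R.

Definition tqd_coassoc : tpow D 3 :=
  \sum_g \sum_h \sum_l
    (w g h l)^-1 *: ten [tuple E g 1%g; E h 1%g; E l 1%g].

Definition tqd_antipodeE g x : D :=
  (theta w g^-1%g x x^-1%g)^-1 * (gamma w x g g^-1%g)^-1
    *: E (x^-1 * g^-1 * x)%g x^-1%g.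

Definition tqd_antipode (u : D) : D := \sum_p (u p : k) *: tqd_antipodeE p.1 p.2.

Definition tqd_alpha : D := 1.

Definition tqd_beta : D := \sum_g w g g^-1%g g *: E g 1%g.

Definition tqd_struct : qbialg D :=
  QBialg tqd_comult tqd_counit tqd_coassoc.

Lemma tqd_sum_lin (V : lmodType k) (f : G * G -> V) :
  linear (fun u : D => \sum_p (u p : k) *: f p).
Proof.
move=> c u v; rewrite scaler_sumr -big_split; apply: eq_bigr => p _ /=.
by rewrite !ffunE scalerDl scalerA.
Qed.

Lemma tqd_sumE (V : lmodType k) (f : G * G -> V) g x :
  \sum_p (E g x p : k) *: f p = f (g, x).
Proof.
rewrite (bigD1 (g, x)) //= big1 ?addr0 => [|p pg].
  by rewrite !ffunE eqxx scale1r.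
by rewrite !ffunE (negPf pg) scale0r.
Qed.

Lemma tqd_comult_lin : linear tqd_comult.
Proof. exact: (tqd_sum_lin (fun p => tqd_comultE p.1 p.2)). Qed.
Lemma tqd_antipode_lin : linear tqd_antipode.
Proof. exact: (tqd_sum_lin (fun p => tqd_antipodeE p.1 p.2)). Qed.
Lemma tqd_counit_lin : scalar tqd_counit.
Proof.
exact: (tqd_sum_lin (V := k^o) (fun p => (p.1 == 1%g)%:R)).
Qed.

Definition tqdB2 g h x : tpow D 2 := ten [tuple E g x; E h x].
Definition tqdB3 g h l x : tpow D 3 := ten [tuple E g x; E h x; E l x].
Definition tqdB4 g h l m x : tpow D 4 := ten [tuple E g x; E h x; E l x; E m x].

Definition tqdF1 (c : G -> k) x : D := \sum_g c g *: E g x.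
Definition tqdF2 (c : G -> G -> k) x := \sum_g \sum_h c g h *: tqdB2 g h x.
Definition tqdF3 (c : G -> G -> G -> k) x :=
  \sum_g \sum_h \sum_l c g h l *: tqdB3 g h l x.
Definition tqdF4 (c : G -> G -> G -> G -> k) x :=
  \sum_g \sum_h \sum_l \sum_m c g h l m *: tqdB4 g h l m x.

Lemma eq_F1 c d x : (forall g, c g = d g) -> tqdF1 c x = tqdF1 d x.
Proof. by move=> cd; apply: eq_bigr => g _; rewrite cd. Qed.
Lemma eq_F2 c d x : (forall g h, c g h = d g h) -> tqdF2 c x = tqdF2 d x.
Proof.
by move=> cd; apply: eq_bigr => g _; apply: eq_bigr => h _; rewrite cd.
Qed.
Lemma eq_F3 c d x : (forall g h l, c g h l = d g h l) -> tqdF3 c x = tqdF3 d x.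
Proof.
move=> cd; apply: eq_bigr => g _; apply: eq_bigr => h _; apply: eq_bigr => l _.
by rewrite cd.
Qed.
Lemma eq_F4 c d x :
  (forall g h l m, c g h l m = d g h l m) -> tqdF4 c x = tqdF4 d x.
Proof.
move=> cd; apply: eq_bigr => g _; apply: eq_bigr => h _; apply: eq_bigr => l _.
by apply: eq_bigr => m _; rewrite cd.
Qed.

Lemma tqdF1_E g x : E g x = tqdF1 (fun h => (h == g)%:R) x.
Proof.
rewrite /tqdF1 (bigD1 g) //= big1 ?addr0 ?eqxx ?scale1r // => h hg.
by rewrite (negPf hg) scale0r.
Qed.

Lemma tqdF1_ext (V : lmodType k) (f f' : D -> V) : linear f -> linear f' ->
  (forall c x, f (tqdF1 c x) = f' (tqdF1 c x)) -> f =1 f'.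
Proof. by move=> fl fl' h; apply: tqd_ext => // g x; rewrite tqdF1_E. Qed.

Lemma tqdF2_P c x : tqdF2 c x = \sum_p c p.1 p.2 *: tqdB2 p.1 p.2 x.
Proof. by rewrite /tqdF2 pair_bigA. Qed.
Lemma tqdF3_P c x :
  tqdF3 c x = \sum_p c p.1.1 p.1.2 p.2 *: tqdB3 p.1.1 p.1.2 p.2 x.
Proof. by rewrite /tqdF3 pair_bigA pair_bigA. Qed.
Lemma tqdF4_P c x : tqdF4 c x =
  \sum_p c p.1.1.1 p.1.1.2 p.1.2 p.2 *: tqdB4 p.1.1.1 p.1.1.2 p.1.2 p.2 x.
Proof. by rewrite /tqdF4 !pair_bigA. Qed.

Lemma tqdF1_1 : tqdF1 (fun=> 1) 1%g = 1.
Proof. by apply: eq_bigr => g _; rewrite scale1r. Qed.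

Lemma tqdF1_M c d x y : tqdF1 c x * tqdF1 d y =
  tqdF1 (fun g => c g * d (g ^ x)%g * theta w g x y) (x * y)%g.
Proof.
exact: (basis_mul (B := E) (cj := fun g x => (g ^ x)%g) (@tqdE_M k G w)).
Qed.

Lemma tqdB2_M g h x g' h' y : tqdB2 g h x * tqdB2 g' h' y =
  if ((g ^ x)%g == g') && ((h ^ x)%g == h') then
    theta w g x y * theta w h x y *: tqdB2 g h (x * y)%g else 0.
Proof.
rewrite ten2M !tqdE_M; case: eqP => _; last by rewrite (plin0 (ten2_lin1 _)).
case: eqP => _ /=; last by rewrite (plin0 (ten2_lin2 _)).
by rewrite (plinZ (ten2_lin1 _)) (plinZ (ten2_lin2 _)) scalerA.
Qed.

Lemma tqdB3_M g h l x g' h' l' y : tqdB3 g h l x * tqdB3 g' h' l' y =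
  if [&& (g ^ x)%g == g', (h ^ x)%g == h' & (l ^ x)%g == l'] then
    theta w g x y * theta w h x y * theta w l x y *: tqdB3 g h l (x * y)%g else 0.
Proof.
rewrite ten3M !tqdE_M; case: eqP => _; last by rewrite (plin0 (ten3_lin1 _ _)).
case: eqP => _ /=; last by rewrite (plin0 (ten3_lin2 _ _)).
case: eqP => _ /=; last by rewrite (plin0 (ten3_lin3 _ _)).
rewrite (plinZ (ten3_lin1 _ _)) (plinZ (ten3_lin2 _ _)).
by rewrite (plinZ (ten3_lin3 _ _)) !scalerA.
Qed.

Lemma tqdB4_M g h l m x g' h' l' m' y : tqdB4 g h l m x * tqdB4 g' h' l' m' y =
  if [&& (g ^ x)%g == g', (h ^ x)%g == h', (l ^ x)%g == l' & (m ^ x)%g == m']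
  then theta w g x y * theta w h x y * theta w l x y * theta w m x y
         *: tqdB4 g h l m (x * y)%g else 0.
Proof.
rewrite ten4M !tqdE_M; case: eqP => _; last by rewrite (plin0 (ten4_lin1 _ _ _)).
case: eqP => _ /=; last by rewrite (plin0 (ten4_lin2 _ _ _)).
case: eqP => _ /=; last by rewrite (plin0 (ten4_lin3 _ _ _)).
case: eqP => _ /=; last by rewrite (plin0 (ten4_lin4 _ _ _)).
rewrite (plinZ (ten4_lin1 _ _ _)) (plinZ (ten4_lin2 _ _ _)).
by rewrite (plinZ (ten4_lin3 _ _ _)) (plinZ (ten4_lin4 _ _ _)) !scalerA.
Qed.

Lemma tqdF2_M c d x y : tqdF2 c x * tqdF2 d y =
  tqdF2 (fun g h => c g h * d (g ^ x)%g (h ^ x)%g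
        * (theta w g x y * theta w h x y)) (x * y)%g.
Proof.
rewrite !tqdF2_P.
apply: (basis_mul (P := (G * G)%type) (B := fun p => tqdB2 p.1 p.2)
  (cj := fun p x => ((p.1 ^ x)%g, (p.2 ^ x)%g))
  (th := fun p x y => theta w p.1 x y * theta w p.2 x y)
  _ (fun p => c p.1 p.2) (fun p => d p.1 p.2)).
by move=> [g h] z [g' h'] t; rewrite tqdB2_M.
Qed.

Lemma tqdF3_M c d x y : tqdF3 c x * tqdF3 d y =
  tqdF3 (fun g h l => c g h l * d (g ^ x)%g (h ^ x)%g (l ^ x)%g
        * (theta w g x y * theta w h x y * theta w l x y)) (x * y)%g.
Proof.
rewrite !tqdF3_P.
apply: (basis_mul (P := (G * G * G)%type) (B := fun p => tqdB3 p.1.1 p.1.2 p.2)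
  (cj := fun p x => ((p.1.1 ^ x)%g, (p.1.2 ^ x)%g, (p.2 ^ x)%g))
  (th := fun p x y => theta w p.1.1 x y * theta w p.1.2 x y * theta w p.2 x y)
  _ (fun p => c p.1.1 p.1.2 p.2) (fun p => d p.1.1 p.1.2 p.2)).
move=> [[g h] l] z [[g' h'] l'] t; rewrite tqdB3_M /=.
by rewrite !xpair_eqE -!andbA.
Qed.

Lemma tqdF4_M c d x y : tqdF4 c x * tqdF4 d y =
  tqdF4 (fun g h l m => c g h l m * d (g ^ x)%g (h ^ x)%g (l ^ x)%g (m ^ x)%g
        * (theta w g x y * theta w h x y * theta w l x y * theta w m x y))
    (x * y)%g.
Proof.
rewrite !tqdF4_P.
apply: (basis_mul (P := (G * G * G * G)%type)
  (B := fun p => tqdB4 p.1.1.1 p.1.1.2 p.1.2 p.2)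
  (cj := fun p x =>
    ((p.1.1.1 ^ x)%g, (p.1.1.2 ^ x)%g, (p.1.2 ^ x)%g, (p.2 ^ x)%g))
  (th := fun p x y => theta w p.1.1.1 x y * theta w p.1.1.2 x y
     * theta w p.1.2 x y * theta w p.2 x y)
  _ (fun p => c p.1.1.1 p.1.1.2 p.1.2 p.2)
  (fun p => d p.1.1.1 p.1.1.2 p.1.2 p.2)).
move=> [[[g h] l] m] z [[[g' h'] l'] m'] t; rewrite tqdB4_M /=.
by rewrite !xpair_eqE -!andbA.
Qed.

Lemma tqd_comult_E g x : tqd_comult (E g x) =
  \sum_h gamma w x h (h^-1 * g)%g *: tqdB2 h (h^-1 * g)%g x.
Proof.
rewrite /tqd_comult (tqd_sumE (fun p => tqd_comultE p.1 p.2)).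
apply: eq_bigr => h _; rewrite (big_pred1 (h^-1 * g)%g) // => l /=.
by apply/eqP/eqP => [<-|->]; rewrite ?mulKg ?mulKVg.
Qed.

Lemma tqd_comult_F1 c x :
  tqd_comult (tqdF1 c x) = tqdF2 (fun h l => c (h * l)%g * gamma w x h l) x.
Proof.
rewrite /tqdF1 (plin_sum tqd_comult_lin) /tqdF2.
under eq_bigr => g _ do rewrite (plinZ tqd_comult_lin) tqd_comult_E scaler_sumr.
rewrite exchange_big; apply: eq_bigr => h _ /=.
rewrite (reindex_inj (mulgI h)); apply: eq_bigr => l _.
by rewrite mulKg scalerA.
Qed.

Lemma tqd_counit_E g x : tqd_counit (E g x) = (g == 1%g)%:R.
Proof. exact: (tqd_sumE (V := k^o) (fun p => (p.1 == 1%g)%:R)). Qed.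

Lemma tqd_counit_F1 c x : tqd_counit (tqdF1 c x) = c 1%g.
Proof.
have cl : linear (tqd_counit : D -> k^o) by exact: tqd_counit_lin.
rewrite /tqdF1 (plin_sum cl) (bigD1 1%g) //= big1 ?addr0 => [|g g1].
  by rewrite (plinZ cl) tqd_counit_E eqxx; apply: mulr1.
by rewrite (plinZ cl) tqd_counit_E (negPf g1); apply: mulr0.
Qed.

Lemma tqd_antipode_E g x :
  tqd_antipode (E g x) = antipode_coef w g x *: E (g^-1 ^ x)%g x^-1%g.
Proof.
rewrite /tqd_antipode (tqd_sumE (fun p => tqd_antipodeE p.1 p.2)).
by rewrite /tqd_antipodeE /= conjgE mulgA.
Qed.

Local Notation Q := tqd_struct.
Let cl := tqd_comult_lin.
Let el := tqd_counit_lin.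

Lemma tqdF2_lin (V : lmodType k) (f : tpow D 2 -> V) c x : linear f ->
  f (tqdF2 c x) = \sum_g \sum_h c g h *: f (tqdB2 g h x).
Proof.
move=> fl; rewrite /tqdF2 plin_sum //; apply: eq_bigr => g _.
by rewrite plin_sum //; apply: eq_bigr => h _; rewrite plinZ.
Qed.

Lemma tqdF3_lin (V : lmodType k) (f : tpow D 3 -> V) c x : linear f ->
  f (tqdF3 c x) = \sum_g \sum_h \sum_l c g h l *: f (tqdB3 g h l x).
Proof.
move=> fl; rewrite /tqdF3 plin_sum //; apply: eq_bigr => g _.
rewrite plin_sum //; apply: eq_bigr => h _.
by rewrite plin_sum //; apply: eq_bigr => l _; rewrite plinZ.
Qed.

Lemma lin_comult_E (V : lmodType k) (f : tpow D 2 -> V) g x : linear f ->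
  f (tqd_comult (E g x)) =
  \sum_h gamma w x h (h^-1 * g)%g *: f (tqdB2 h (h^-1 * g)%g x).
Proof.
move=> fl; rewrite tqd_comult_E plin_sum //.
by apply: eq_bigr => h _; rewrite plinZ.
Qed.

Lemma comult_l_F2 c x : comult_l Q (tqdF2 c x) =
  tqdF3 (fun g h l => c (g * h)%g l * gamma w x g h) x.
Proof.
rewrite (tqdF2_lin _ _ (comult_l_lin (q := Q) cl)).
under eq_bigr => g _ do under eq_bigr => h _ do
  rewrite (comult_l_ten (q := Q) cl) (lin_comult_E _ _ (tcat_linear_l _)) scaler_sumr.
under eq_bigr => g _ do rewrite exchange_big.
rewrite exchange_big; apply: eq_bigr => h _ /=.
rewrite (reindex_inj (mulgI h)); apply: eq_bigr => g _.
by apply: eq_bigr => l _; rewrite mulKg scalerA tcat_ten; congr (_ *: ten _); apply: val_inj.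
Qed.

Lemma comult_r_F2 c x : comult_r Q (tqdF2 c x) =
  tqdF3 (fun g h l => c g (h * l)%g * gamma w x h l) x.
Proof.
rewrite (tqdF2_lin _ _ (comult_r_lin (q := Q) cl)).
under eq_bigr => g _ do under eq_bigr => h _ do
  rewrite (comult_r_ten (q := Q) cl) (lin_comult_E _ _ (tcat_linear_r _)) scaler_sumr.
apply: eq_bigr => g _; rewrite exchange_big; apply: eq_bigr => h _ /=.
rewrite (reindex_inj (mulgI h)); apply: eq_bigr => l _.
by rewrite mulKg scalerA tcat_ten; congr (_ *: ten _); apply: val_inj.
Qed.

Lemma comult_ll_F3 c x : comult_ll Q (tqdF3 c x) =
  tqdF4 (fun g h l m => c (g * h)%g l m * gamma w x g h) x.
Proof.
rewrite (tqdF3_lin _ _ (comult_ll_lin (q := Q) cl)).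
under eq_bigr => g _ do under eq_bigr => h _ do under eq_bigr => l _ do
  rewrite (comult_ll_ten (q := Q) cl) (lin_comult_E _ _ (tcat_linear_l _)) scaler_sumr.
under eq_bigr => g _ do under eq_bigr => h _ do rewrite exchange_big.
under eq_bigr => g _ do rewrite exchange_big.
rewrite exchange_big; apply: eq_bigr => h _ /=.
rewrite (reindex_inj (mulgI h)); apply: eq_bigr => g _.
apply: eq_bigr => l _; apply: eq_bigr => m _.
by rewrite mulKg scalerA tcat_ten; congr (_ *: ten _); apply: val_inj.
Qed.

Lemma comult_mm_F3 c x : comult_mm Q (tqdF3 c x) =
  tqdF4 (fun g h l m => c g (h * l)%g m * gamma w x h l) x.
Proof.
rewrite (tqdF3_lin _ _ (comult_mm_lin (q := Q) cl)).
under eq_bigr => g _ do under eq_bigr => h _ do under eq_bigr => l _ do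
  rewrite (comult_mm_ten (q := Q) cl)
   (lin_comult_E (f := fun t => tcat (ten [tuple E g x]) (tcat t (ten [tuple E l x])))
     _ _ (plin_comp (@tcat_linear_r k D 1 3 _) (@tcat_linear_l k D 2 1 _)))
   scaler_sumr.
apply: eq_bigr => g _.
under eq_bigr => h _ do rewrite exchange_big.
rewrite exchange_big; apply: eq_bigr => h _ /=.
rewrite (reindex_inj (mulgI h)); apply: eq_bigr => l _.
apply: eq_bigr => m _.
by rewrite mulKg scalerA !tcat_ten; congr (_ *: ten _); apply: val_inj.
Qed.

Lemma comult_rr_F3 c x : comult_rr Q (tqdF3 c x) =
  tqdF4 (fun g h l m => c g h (l * m)%g * gamma w x l m) x.
Proof.
rewrite (tqdF3_lin _ _ (comult_rr_lin (q := Q) cl)).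
under eq_bigr => g _ do under eq_bigr => h _ do under eq_bigr => l _ do
  rewrite (comult_rr_ten (q := Q) cl) (lin_comult_E _ _ (tcat_linear_r _)) scaler_sumr.
apply: eq_bigr => g _; apply: eq_bigr => h _.
rewrite exchange_big; apply: eq_bigr => l _ /=.
rewrite (reindex_inj (mulgI l)); apply: eq_bigr => m _.
by rewrite mulKg scalerA !tcat_ten; congr (_ *: ten _); apply: val_inj.
Qed.

Lemma tcat_1_F3 c : tcat (1 : tpow D 1) (tqdF3 c 1%g) =
  tqdF4 (fun _ h l m => c h l m) 1%g.
Proof.
rewrite -ten1_1 -tqdF1_1 (plin_sum (@ten1_lin k D)) (plin_sum (@tcat_linear_l k D 1 3 _)).
apply: eq_bigr => g _; rewrite scale1r (tqdF3_lin _ _ (@tcat_linear_r k D 1 3 _)).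
apply: eq_bigr => h _; apply: eq_bigr => l _; apply: eq_bigr => m _.
by rewrite tcat_ten; congr (_ *: ten _); apply: val_inj.
Qed.

Lemma tcat_F3_1 c : tcat (tqdF3 c 1%g) (1 : tpow D 1) =
  tqdF4 (fun g h l _ => c g h l) 1%g.
Proof.
rewrite (tqdF3_lin _ _ (@tcat_linear_l k D 3 1 _)).
apply: eq_bigr => g _; apply: eq_bigr => h _; apply: eq_bigr => l _.
rewrite -ten1_1 -tqdF1_1 (plin_sum (@ten1_lin k D)) (plin_sum (@tcat_linear_r k D 3 1 _)).
rewrite scaler_sumr; apply: eq_bigr => m _; rewrite scale1r.
by rewrite tcat_ten; congr (_ *: ten _); apply: val_inj.
Qed.

Lemma tqdF2_1 : tqdF2 (fun _ _ => 1) 1%g = 1.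
Proof.
rewrite -ten2_1 -[in RHS]tqdF1_1 (plin_sum (ten2_lin1 _)).
apply: eq_bigr => g _; rewrite scale1r (plin_sum (ten2_lin2 _)).
by apply: eq_bigr => h _; rewrite !scale1r.
Qed.

Lemma tqdF3_1 : tqdF3 (fun _ _ _ => 1) 1%g = 1.
Proof.
rewrite -ten3_1 -[in RHS]tqdF1_1 (plin_sum (ten3_lin1 _ _)).
apply: eq_bigr => g _; rewrite scale1r (plin_sum (ten3_lin2 _ _)).
apply: eq_bigr => h _; rewrite scale1r (plin_sum (ten3_lin3 _ _)).
by apply: eq_bigr => l _; rewrite !scale1r.
Qed.

Lemma coassoc_F3 : tqd_coassoc = tqdF3 (fun g h l => (w g h l)^-1) 1%g.
Proof. by []. Qed.

Lemma counit_l_F2 c x : counit_l Q (tqdF2 c x) = tqdF1 (c 1%g) x.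
Proof.
rewrite (tqdF2_lin _ _ (counit_l_lin (q := Q) el)).
rewrite (bigD1 1%g) //= [X in _ + X]big1 ?addr0 => [|g g1].
  apply: eq_bigr => h _; rewrite (counit_l_ten (q := Q) el) /=.
  by rewrite tqd_counit_E eqxx scale1r.
apply: big1 => h _; rewrite (counit_l_ten (q := Q) el) /=.
by rewrite tqd_counit_E (negPf g1) scale0r scaler0.
Qed.

Lemma counit_r_F2 c x : counit_r Q (tqdF2 c x) = tqdF1 (c^~ 1%g) x.
Proof.
rewrite (tqdF2_lin _ _ (counit_r_lin (q := Q) el)); apply: eq_bigr => g _.
rewrite (bigD1 1%g) //= [X in _ + X]big1 ?addr0 => [|h h1];
  rewrite (counit_r_ten (q := Q) el) /= tqd_counit_E.
  by rewrite eqxx scale1r.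
by rewrite (negPf h1) scale0r scaler0.
Qed.

Lemma counit_m_F3 c x : counit_m Q (tqdF3 c x) = tqdF2 (fun g l => c g 1%g l) x.
Proof.
rewrite (tqdF3_lin _ _ (counit_m_lin (q := Q) el)); apply: eq_bigr => g _.
rewrite (bigD1 1%g) //= [X in _ + X]big1 ?addr0 => [|h h1].
  apply: eq_bigr => l _; rewrite (counit_m_ten (q := Q) el) /= tqd_counit_E.
  by rewrite (eqxx (1%g : G)) scale1r.
apply: big1 => l _; rewrite (counit_m_ten (q := Q) el) /= tqd_counit_E.
by rewrite (negPf h1) scale0r scaler0.
Qed.

Let wn0 g h l : w g h l != 0. Proof. exact: cocycle3_neq0. Qed.
Let cj1 g : (g ^ 1)%g = g. Proof. exact: conjg1. Qed.

Definition tqd_coassocV : tpow D 3 := tqdF3 (fun g h l => w g h l) 1%g.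

Lemma tqd_coassocK : tqd_coassoc * tqd_coassocV = 1.
Proof.
rewrite coassoc_F3 tqdF3_M mulg1 -tqdF3_1; apply: eq_F3 => g h l.
by rewrite !cj1 !theta_1r !mulr1 mulVf.
Qed.
Lemma tqd_coassocVK : tqd_coassocV * tqd_coassoc = 1.
Proof.
rewrite coassoc_F3 tqdF3_M mulg1 -tqdF3_1; apply: eq_F3 => g h l.
by rewrite !cj1 !theta_1r !mulr1 mulfV.
Qed.

Lemma tqd_is_quasi_bialgebra : is_quasi_bialgebra Q.
Proof.
split.
- exact: cl.
- rewrite /= -tqdF1_1 tqd_comult_F1 -tqdF2_1; apply: eq_F2 => g h.
  by rewrite gamma_1 mulr1.
- move=> a b /=.
  apply: (tqdF1_ext (f := fun a => tqd_comult (a * b))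
    (f' := fun a => tqd_comult a * tqd_comult b)) => [||c x].
  + by move=> c u v; rewrite mulrDl -scalerAl cl.
  + by move=> c u v; rewrite cl mulrDl -scalerAl.
  apply: (tqdF1_ext (f := fun b => tqd_comult (tqdF1 c x * b))
    (f' := fun b => tqd_comult (tqdF1 c x) * tqd_comult b)) => [||d y].
  + by move=> e u v; rewrite mulrDr -scalerAr cl.
  + by move=> e u v; rewrite cl mulrDr -scalerAr.
  rewrite tqdF1_M !tqd_comult_F1 tqdF2_M; apply: eq_F2 => g h.
  rewrite conjMg; transitivity (c (g * h)%g * d (g ^ x * h ^ x)%g *
    (theta w (g * h)%g x y * gamma w (x * y)%g g h)); first by ring.
  by rewrite theta_gamma; ring.
- exact: el.
- by rewrite /= -tqdF1_1 tqd_counit_F1.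
- move=> a b /=.
  apply: (tqdF1_ext (V := k^o) (f := fun a => tqd_counit (a * b))
    (f' := fun a => tqd_counit a * tqd_counit b)) => [||c x].
  + by move=> c u v; rewrite mulrDl -scalerAl el.
  + by move=> c u v; rewrite el mulrDl -mulrA.
  apply: (tqdF1_ext (V := k^o) (f := fun b => tqd_counit (tqdF1 c x * b))
    (f' := fun b => tqd_counit (tqdF1 c x) * tqd_counit b)) => [||d y].
  + by move=> e u v; rewrite mulrDr -scalerAr el.
  + by move=> e u v; rewrite el mulrDr mulrCA.
  by rewrite tqdF1_M !tqd_counit_F1 conj1g theta_1l mulr1.
- apply: tqdF1_ext => [||c x] //.
    exact: plin_comp (counit_l_lin (q := Q) el) cl.
  rewrite /= tqd_comult_F1 counit_l_F2; apply: eq_F1 => g.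
  by rewrite gamma_1l mul1g mulr1.
- apply: tqdF1_ext => [||c x] //.
    exact: plin_comp (counit_r_lin (q := Q) el) cl.
  rewrite /= tqd_comult_F1 counit_r_F2; apply: eq_F1 => g.
  by rewrite gamma_1r mulg1 mulr1.
- by exists tqd_coassocV; split; [exact: tqd_coassocK | exact: tqd_coassocVK].
- apply: tqdF1_ext => [||c x].
  + move=> c u v; rewrite /= cl (comult_r_lin (q := Q) cl).
    by rewrite mulrDl -scalerAl.
  + move=> c u v; rewrite /= cl (comult_l_lin (q := Q) cl).
    by rewrite mulrDr -scalerAr.
  rewrite /= tqd_comult_F1 comult_r_F2 comult_l_F2 coassoc_F3 !tqdF3_M.
  rewrite mulg1 mul1g; apply: eq_F3 => g h l.
  rewrite !cj1 !theta_1r !theta_1m !mulr1 mulgA.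
  apply: (mulIf (mulf_neq0 (wn0 g h l) (wn0 (g ^ x)%g (h ^ x)%g (l ^ x)%g))).
  rewrite [LHS](_ : _ = c (g * h * l)%g *
     (gamma w x g (h * l)%g * gamma w x h l * w g h l)).
    by rewrite gammaM; field; rewrite wn0.
  by field; rewrite wn0.
- rewrite /= coassoc_F3 comult_rr_F3 comult_ll_F3 comult_mm_F3.
  rewrite tcat_1_F3 tcat_F3_1 !tqdF4_M !mulg1; apply: eq_F4 => g h l m.
  rewrite !cj1 !theta_1r !gamma_1 !mulr1 -!invfM.
  by rewrite cocycle3_eq mulrC.
- rewrite /= coassoc_F3 counit_m_F3 -tqdF2_1; apply: eq_F2 => g h.
  by rewrite cocycle3_1m invr1.
Qed.

Lemma tqd_antipode_M g x h y :
  tqd_antipode (E g x * E h y) = tqd_antipode (E h y) * tqd_antipode (E g x).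
Proof.
rewrite tqdE_M (tqd_antipode_E h) (tqd_antipode_E g).
rewrite -scalerAl -scalerAr tqdE_M -conjgM mulgV conjg1.
case: eqP => [<-|gh]; last first.
  rewrite (plin0 tqd_antipode_lin); case: eqP => [E|_]; last by rewrite !scaler0.
  by case: gh; apply: invg_inj; rewrite E conjVg.
rewrite (plinZ tqd_antipode_lin) tqd_antipode_E.
rewrite -conjVg eqxx !scalerA antipode_coefM invMg -conjgM.
by congr (_ *: _).
Qed.

Lemma antipode_mul_E g h x :
  tqd_antipode (E g x) * tqd_alpha * E h x =
  if g^-1%g == h then antipode_coef w g x * theta w g^-1%g x x^-1%g *: E (g^-1 ^ x)%g 1%g
  else 0.
Proof.
rewrite mulr1 tqd_antipode_E -scalerAl tqdE_M -conjgM mulgV conjg1 mulVg.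
by case: eqP => _; rewrite ?scaler0 // scalerA theta_inv.
Qed.

Lemma E_mul_beta g x : E g x * tqd_beta =
  w (g ^ x)%g (g ^ x)^-1%g (g ^ x)%g *: E g x.
Proof.
rewrite /tqd_beta mulr_sumr (bigD1 (g ^ x)%g) //= big1 ?addr0 => [|h hg].
  by rewrite -scalerAr tqdE_M eqxx theta_1r scale1r mulg1.
by rewrite -scalerAr tqdE_M eq_sym (negPf hg) scaler0.
Qed.

Lemma mul_antipode_E g h x :
  E g x * tqd_beta * tqd_antipode (E h x) =
  if g^-1%g == h then
    w (g ^ x)%g (g ^ x)^-1%g (g ^ x)%g * antipode_coef w g^-1%g x * theta w g x x^-1%g
      *: E g 1%g
  else 0.
Proof.
rewrite E_mul_beta tqd_antipode_E -scalerAl -scalerAr tqdE_M mulgV.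
have -> : ((g ^ x)%g == (h^-1 ^ x)%g) = (g^-1%g == h).
  rewrite (inj_eq (conjg_inj x)).
  by apply/eqP/eqP => [->|<-]; rewrite invgK.
by case: eqP => [<-|_]; rewrite ?scaler0 // !scalerA.
Qed.

Let Sl := tqd_antipode_lin.

Let mull (b : D) (f : D -> D) : linear f -> linear (fun a => f a * b).
Proof. by move=> fl c u v; rewrite fl mulrDl scalerAl. Qed.
Let mulr (a : D) (f : D -> D) : linear f -> linear (fun b => a * f b).
Proof. by move=> fl c u v; rewrite fl mulrDr scalerAr. Qed.
Let idl : linear (fun a : D => a). Proof. by []. Qed.

Lemma lift2_F2 (f : D -> D -> D) c x :
  (forall b, linear (f^~ b)) -> (forall a, linear (f a)) ->
  lift2 f (tqdF2 c x) = \sum_g \sum_h c g h *: f (E g x) (E h x).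
Proof.
move=> fl fr; rewrite (tqdF2_lin _ _ (lift2_linear fl fr)).
by do 2!apply: eq_bigr => ? _; rewrite lift2_ten.
Qed.

Lemma lift3_F3 (f : D -> D -> D -> D) c x :
  (forall b c, linear (fun a => f a b c)) ->
  (forall a c, linear (fun b => f a b c)) -> (forall a b, linear (f a b)) ->
  lift3 f (tqdF3 c x) =
  \sum_g \sum_h \sum_l c g h l *: f (E g x) (E h x) (E l x).
Proof.
move=> fl fm fr; rewrite (tqdF3_lin _ _ (lift3_linear fl fm fr)).
by do 3!apply: eq_bigr => ? _; rewrite lift3_ten.
Qed.

Lemma tqd_is_quasi_antipode :
  is_quasi_antipode Q tqd_antipode tqd_alpha tqd_beta.
Proof.
have al b : linear (fun a => tqd_antipode a * tqd_alpha * b).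
  by apply: mull; apply: mull.
have ar a : linear (fun b => tqd_antipode a * tqd_alpha * b) by apply: mulr.
have bl b : linear (fun a => a * tqd_beta * tqd_antipode b).
  by apply: mull; apply: mull.
have br a : linear (fun b => a * tqd_beta * tqd_antipode b) by apply: mulr.
split.
- exact: Sl.
- rewrite -[in LHS]tqdF1_1 (plin_sum Sl) -tqdF1_1 /tqdF1 (reindex_inj invg_inj).
  apply: eq_bigr => g _; rewrite scale1r tqd_antipode_E /antipode_coef invg1 gamma_1.
  by rewrite theta_1r invr1 mulr1 conjg1 invgK.
- move=> a b.
  apply: (tqd_ext (f := fun a => tqd_antipode (a * b))
    (f' := fun a => tqd_antipode b * tqd_antipode a)) => [||g x].
  + by move=> c u v; rewrite mulrDl -scalerAl Sl.
  + exact: mulr.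
  apply: (tqd_ext (f := fun b => tqd_antipode (E g x * b))
    (f' := fun b => tqd_antipode b * tqd_antipode (E g x))) => [||h y].
  + by move=> e u v; rewrite mulrDr -scalerAr Sl.
  + exact: mull.
  exact: tqd_antipode_M.
- apply: tqdF1_ext => [||c x].
  + by apply: plin_comp cl; apply: lift2_linear.
  + by move=> c u v; rewrite /= el scalerDl scalerA.
  rewrite /= tqd_comult_F1 (lift2_F2 _ _ al ar) tqd_counit_F1 [in RHS]/tqd_alpha -tqdF1_1 scaler_sumr.
  rewrite [RHS](reindex_inj (inj_comp (conjg_inj x) invg_inj)).
  apply: eq_bigr => g _; rewrite (bigD1 g^-1%g) //= [X in _ + X]big1 ?addr0
    => [|h hg]; rewrite antipode_mul_E; last by rewrite eq_sym (negPf hg) scaler0.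
  rewrite eqxx mulgV scale1r scalerA; congr (_ *: _).
  by rewrite /antipode_coef; field; rewrite theta_neq0 gamma_neq0.
- apply: tqdF1_ext => [||c x].
  + by apply: plin_comp cl; apply: lift2_linear.
  + by move=> c u v; rewrite /= el scalerDl scalerA.
  rewrite /= tqd_comult_F1 (lift2_F2 _ _ bl br) tqd_counit_F1 /tqd_beta scaler_sumr.
  apply: eq_bigr => g _; rewrite (bigD1 g^-1%g) //= [X in _ + X]big1 ?addr0
    => [|h hg]; rewrite mul_antipode_E; last by rewrite eq_sym (negPf hg) scaler0.
  rewrite eqxx mulgV !scalerA; congr (_ *: _).
  have := gamma_inv w g x; rewrite /antipode_coef invgK => H.
  transitivity (c 1%g * (gamma w x g g^-1%g *
     w (g ^ x)%g (g ^ x)^-1%g (g ^ x)%g) / gamma w x g^-1%g g).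
    by field; rewrite theta_neq0 gamma_neq0.
  by rewrite H; field; rewrite gamma_neq0.
- rewrite /= coassoc_F3 lift3_F3 => [|? ?|? ?|? ?]; last first.
  + exact: mulr.
  + by apply: mull; apply: mull; apply: mulr.
  + by do 4!apply: mull.
  rewrite -tqdF1_1; apply: eq_bigr => g _.
  rewrite (bigD1 g^-1%g) //= [X in _ + X]big1 ?addr0 => [|h hg]; last first.
    apply: big1 => l _.
    by rewrite mul_antipode_E eq_sym (negPf hg) mul0r mul0r scaler0.
  rewrite (bigD1 g) //= [X in _ + X]big1 ?addr0 => [|l lg]; last first.
    rewrite mul_antipode_E eqxx mulr1 -scalerAl tqdE_M conjg1 eq_sym (negPf lg).
    by rewrite !scaler0.
  rewrite mul_antipode_E eqxx mulr1 -scalerAl tqdE_M conjg1 eqxx.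
  rewrite !scalerA mulg1 ?conjg1 /antipode_coef invg1 !theta_1r gamma_1 !(invr1, mulr1).
  by rewrite mulVf.
move=> psi h1 h2.
have -> : psi = tqd_coassocV.
  by rewrite -[psi]mul1r -tqd_coassocVK -mulrA h1 mulr1.
rewrite /tqd_coassocV lift3_F3 => [|? ?|? ?|? ?]; last first.
+ exact: mulr.
+ by do 2!apply: mull; apply: mulr.
+ by do 4!apply: mull.
rewrite -tqdF1_1 /tqdF1 [RHS](reindex_inj invg_inj); apply: eq_bigr => g _.
rewrite (bigD1 g^-1%g) //= [X in _ + X]big1 ?addr0 => [|h hg]; last first.
  apply: big1 => l _.
  by rewrite antipode_mul_E eq_sym (negPf hg) !mul0r scaler0.
have SE l : tqd_antipode (E l 1%g) = E l^-1%g 1%g.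
  by rewrite tqd_antipode_E /antipode_coef invg1 gamma_1 theta_1r invr1 mulr1 scale1r conjg1.
rewrite (bigD1 g) //= [X in _ + X]big1 ?addr0 => [|l lg]; last first.
  rewrite antipode_mul_E eqxx -!scalerAl E_mul_beta -!scalerAl SE tqdE_M !conjg1.
  by rewrite (inj_eq invg_inj) eq_sym (negPf lg) !scaler0.
rewrite antipode_mul_E eqxx -!scalerAl E_mul_beta -!scalerAl SE tqdE_M !conjg1.
rewrite eqxx !scalerA mulg1 /antipode_coef invg1 gamma_1 !theta_1r invr1 !mulr1 invgK.
by rewrite mul1r cocycle3_inv.
Qed.

Definition twisted_double : quasi_hopf k :=
  QuasiHopf tqd_is_quasi_bialgebra tqd_is_quasi_antipode.

End TwistedDoubleStructure.

(* Main.v *)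
Require Import Defs.
From mathcomp Require Import all_boot all_order all_algebra all_fingroup.
From mathcomp Require Import boolp ring cyclic.
Set Implicit Arguments. Unset Strict Implicit. Unset Printing Implicit Defensive.
Import GRing.Theory.
Local Open Scope ring_scope.

(** Write z for the root of unity and D for the twisted double of Z_m. The
    cocycle is symmetric in its last two arguments, so theta = gamma = w and D is
    commutative. Twisting a commutative quasi-Hopf algebra by F does not change
    its coproduct, so D fails to be genuine exactly when some twist makes its
    associator trivial ([twist_trivial_of_hopf], [twist_trivial_gauge]).

    The algebra characters of D are indexed by the pairs (i, c) with
    c ^ m = z ^ (a i): such a character is supported on the part e(g^i) ox kG and
    sends e(g^i) ox g to c. Under convolution they form an extension of Z_m by
    the m-th roots of unity, (i, c) (j, d) being
    (i + j, c d z ^ (a [(i + j) / m])), and the inverse of the associator,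
    evaluated on triples of characters, is the pullback of w. A trivializing
    twist F exhibits this pullback as the coboundary of the function
    (x, y) |-> (x ox y)(F).

    If such an F exists, restrict to the cyclic group generated by the character
    (1, xi), with xi ^ m = z ^ a. Its m-th power is (0, z ^ (2 a)), so that its
    order N is m n with n = m / (m, 2a). The product of a 3-coboundary over the
    triples (u, u^i, u) with i < N telescopes to 1 ([cyclic_obstruction]), while
    that of the associator is z ^ (- a n), because exactly n carries occur
    ([sum_carry]). So m divides a n, that is, (m, 2a) divides a
    ([cyclic_double_obstruction]).

    If conversely (m, 2a) divides a, there is t with 2 a t = a modulo m. Writing
    a character as (i, xi ^ i z ^ s), the coordinate s is additive up to 2 a times
    the carry of the Z_m-components; hence t s is additive up to a times the
    carry, and z ^ (t i(x) s(y)) is a 2-cochain whose coboundary is the pullback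
    of w. In D this cochain is the value of the twist
    sum_i e(g^i) ox V^i, where V is the element whose value at (i, xi ^ i z ^ s)
    is z ^ (t s) ([fibre_coord], [partial_twist_trivial],
    [cyclic_double_not_genuine]). *)

(** * Tensor powers of an algebra *)

Lemma tuple2P (T : Type) (P : T -> Prop) (x y : T) :
  P x -> P y -> forall i, P (tnth [tuple x; y] i).
Proof. by move=> ? ? [[|[|//]] ?]. Qed.
Lemma tuple3P (T : Type) (P : T -> Prop) (x y z : T) :
  P x -> P y -> P z -> forall i, P (tnth [tuple x; y; z] i).
Proof. by move=> ? ? ? [[|[|[|//]]] ?]. Qed.

Section TensorAlgebra.
Variables (k : fieldType) (A : algType k).

Lemma tpow2_ext (V : lmodType k) (f f' : tpow A 2 -> V) :
  linear f -> linear f' ->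
  (forall a b, f (ten [tuple a; b]) = f' (ten [tuple a; b])) -> f =1 f'.
Proof.
move=> fl fl' h; apply: tpow_ext => // p.
case/tupleP: p => a p; case/tupleP: p => b p; rewrite (tuple0 p).
by have := h a b; congr (f (ten _) = f' (ten _)); apply: val_inj.
Qed.

Lemma tcat11 m n : tcat (1 : tpow A m) (1 : tpow A n) = 1.
Proof.
rewrite -!ten1 tcat_ten; congr ten; apply: eq_from_tnth => i.
rewrite tnth_mktuple; case: (split_ordP i) => j ->.
  by rewrite tnth_lshift tnth_mktuple.
by rewrite tnth_rshift tnth_mktuple.
Qed.

Lemma mul_tuple_cat m n (p p' : m.-tuple A) (q q' : n.-tuple A) :
  mul_tuple [tuple of p ++ q] [tuple of p' ++ q'] =
  [tuple of mul_tuple p p' ++ mul_tuple q q'].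
Proof.
apply: eq_from_tnth => i; rewrite tnth_mktuple.
case: (split_ordP i) => j ->; first by rewrite !tnth_lshift tnth_mktuple.
by rewrite !tnth_rshift tnth_mktuple.
Qed.

Lemma tcatM m n (s s' : tpow A m) (t t' : tpow A n) :
  tcat s t * tcat s' t' = tcat (s * s') (t * t').
Proof.
pose L := @tcat_linear_l k A m n; pose R := @tcat_linear_r k A m n.
have ML j (u : tpow A j) c x y : (c *: x + y) * u = c *: (x * u) + y * u.
  by rewrite mulrDl scalerAl.
have MR j (u : tpow A j) c x y : u * (c *: x + y) = c *: (u * x) + u * y.
  by rewrite mulrDr scalerAr.
move: s; apply: tpow_ext => [c x y|c x y|p]; rewrite ?(L, ML) //.
move: s'; apply: tpow_ext => [c x y|c x y|p']; rewrite ?(L, MR) //.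
move: t; apply: tpow_ext => [c x y|c x y|q]; rewrite ?(R, ML) //.
move: t'; apply: tpow_ext => [c x y|c x y|q']; rewrite ?(R, MR) //.
by rewrite !tcat_ten !tenM tcat_ten mul_tuple_cat.
Qed.

Lemma tmap_id n (t : tpow A n) : tmap idfun t = t.
Proof.
have m0 (p : n.-tuple A) : map_tuple idfun p = p by apply: val_inj; rewrite /= map_id.
have ml : multilinear (fun p : n.-tuple A => ten (map_tuple idfun p)).
  by move=> p i c x y; rewrite !m0; apply: ten_multilinear.
move: t; apply: (tpow_ext (g := id)) => // [|p]; first exact: tlift_is_linear.
by rewrite /tmap tlift_ten // m0.
Qed.

End TensorAlgebra.

Lemma tmap1 (k : fieldType) (A B : algType k) (f : {lrmorphism A -> B}) n :
  tmap f (1 : tpow A n) = 1.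
Proof.
rewrite -!ten1 /tmap tlift_ten; last first.
  have E (p : n.-tuple A) i x :
      map_tuple f (tuple_upd p i x) = tuple_upd (map_tuple f p) i (f x).
    apply: eq_from_tnth => j; rewrite tnth_map !tnth_upd tnth_map.
    by case: eqP.
  by move=> p i c x y; rewrite !E linearP; apply: ten_multilinear.
by congr ten; apply: eq_from_tnth => i; rewrite tnth_map !tnth_mktuple rmorph1.
Qed.

Lemma tpow_comm (k : fieldType) (A : algType k) n :
  commutative (@GRing.mul A) -> commutative (@GRing.mul (tpow A n)).
Proof.
move=> AC s t.
have ML (u : tpow A n) c x y : (c *: x + y) * u = c *: (x * u) + y * u.
  by rewrite mulrDl scalerAl.
have MR (u : tpow A n) c x y : u * (c *: x + y) = c *: (u * x) + u * y.
  by rewrite mulrDr scalerAr.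
move: s; apply: tpow_ext => [c x y|c x y|p]; rewrite ?(ML, MR) //.
move: t; apply: tpow_ext => [c x y|c x y|q]; rewrite ?(ML, MR) //.
by rewrite !tenM; congr ten; apply: eq_from_tnth => i; rewrite !tnth_mktuple AC.
Qed.

(** * Characters and the obstruction to trivializing an associator *)

Section Characters.
Variables (k : fieldType) (A : algType k).

Definition is_character (x : A -> k) :=
  [/\ scalar x, x 1 = 1 & {morph x : a b / a * b}].

(** The linear extension of X_1 ox ... ox X_n; it is multiplicative when the X_i
    are characters. *)
Definition teval n (X : n.-tuple (A -> k)) : tpow A n -> k :=
  tlift (fun p => \prod_(i < n) tnth X i (tnth p i) : k^o).

Section Linear.
Variables (n : nat) (X : n.-tuple (A -> k)).
Hypothesis Xl : forall i, scalar (tnth X i).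

Lemma teval_multilinear :
  multilinear (fun p : n.-tuple A => \prod_(i < n) tnth X i (tnth p i) : k^o).
Proof.
move=> p i c x y.
have upd z : \prod_(j < n) tnth X j (tnth (tuple_upd p i z) j) =
    tnth X i z * \prod_(j < n | j != i) tnth X j (tnth p j).
  rewrite (bigD1 i) //= tnth_upd eqxx; congr (_ * _).
  by apply: eq_bigr => j ji; rewrite tnth_upd (negPf ji).
by rewrite !upd Xl mulrDl -mulrA.
Qed.

Lemma teval_lin : scalar (teval X).
Proof. exact: (tlift_is_linear teval_multilinear). Qed.

Lemma teval_ten p : teval X (ten p) = \prod_(i < n) tnth X i (tnth p i).
Proof. exact: (tlift_ten _ teval_multilinear). Qed.

End Linear.

Lemma teval_tcat m n (X : m.-tuple (A -> k)) (Y : n.-tuple (A -> k))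
    (Z : (m + n).-tuple (A -> k)) s t :
  (forall i, scalar (tnth Z i)) -> tval Z = X ++ Y ->
  teval Z (tcat s t) = teval X s * teval Y t.
Proof.
move=> Zl ZE.
have {}ZE : Z = [tuple of X ++ Y] by apply: val_inj.
have ZX i : tnth Z (lshift n i) = tnth X i by rewrite ZE tnth_lshift.
have ZY i : tnth Z (rshift m i) = tnth Y i by rewrite ZE tnth_rshift.
have Xl i : scalar (tnth X i) by rewrite -ZX.
have Yl i : scalar (tnth Y i) by rewrite -ZY.
move: s; apply: (tpow_ext (V := k^o) (f := fun s => teval Z (tcat s t))
    (g := fun s => teval X s * teval Y t)) => [c x y|c x y|p].
- by rewrite tcat_linear_l teval_lin.
- by rewrite teval_lin // mulrDl -mulrA.
move: t; apply: (tpow_ext (V := k^o) (f := fun t => teval Z (tcat (ten p) t))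
    (g := fun t => teval X (ten p) * teval Y t)) => [c x y|c x y|q].
- by rewrite tcat_linear_r teval_lin.
- by rewrite (teval_lin Yl) mulrDr mulrCA.
rewrite tcat_ten !teval_ten // big_split_ord; congr (_ * _).
  by apply: eq_bigr => i _; rewrite ZX tnth_lshift.
by apply: eq_bigr => i _; rewrite ZY tnth_rshift.
Qed.

Section Multiplicative.
Variables (n : nat) (X : n.-tuple (A -> k)).
Hypothesis Xc : forall i, is_character (tnth X i).
Let Xl i : scalar (tnth X i). Proof. by case: (Xc i). Qed.

Lemma teval1 : teval X 1 = 1.
Proof.
rewrite -ten1 teval_ten // big1 // => i _; rewrite tnth_mktuple.
by case: (Xc i).
Qed.

Lemma tevalM : {morph teval X : s t / s * t}.
Proof.
move=> s t.
move: s; apply: (tpow_ext (V := k^o) (f := fun s => teval X (s * t))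
    (g := fun s => teval X s * teval X t)) => [c x y|c x y|p].
- by rewrite mulrDl -scalerAl teval_lin.
- by rewrite teval_lin // mulrDl -mulrA.
move: t; apply: (tpow_ext (V := k^o) (f := fun t => teval X (ten p * t))
    (g := fun t => teval X (ten p) * teval X t)) => [c x y|c x y|q].
- by rewrite mulrDr -scalerAr teval_lin.
- by rewrite (teval_lin Xl) mulrDr mulrCA.
rewrite tenM !teval_ten // -big_split; apply: eq_bigr => i _.
by rewrite tnth_mktuple; case: (Xc i) => _ _ ->.
Qed.

End Multiplicative.

Lemma teval1_ten x a : scalar x -> teval [tuple x] (ten [tuple a]) = x a.
Proof.
by move=> xl; rewrite teval_ten ?big_ord1 // => -[[|//] ?].
Qed.

Section Convolution.
Variable q : qbialg A.
Hypothesis dl : linear (comult q).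

(** The product of linear forms dual to the coproduct: on characters it is the
    tensor product of one-dimensional representations. *)
Definition conv (x y : A -> k) : A -> k := fun a => teval [tuple x; y] (comult q a).

Lemma conv_lin x y : scalar x -> scalar y -> scalar (conv x y).
Proof. by move=> xl yl c a b; rewrite /conv dl teval_lin //; apply: tuple2P. Qed.

Variables (x y z : A -> k).
Hypotheses (xl : scalar x) (yl : scalar y) (zl : scalar z).
Let xyz_lin := tuple3P (P := fun x => scalar x) xl yl zl.

Lemma teval_comult_l F :
  teval [tuple x; y; z] (comult_l q F) = teval [tuple conv x y; z] F.
Proof.
have cl : forall i, scalar (tnth [tuple conv x y; z] i).
  by apply: tuple2P => //; apply: conv_lin.
move: F; apply: (tpow2_ext (V := k^o)
    (f := fun F => teval [tuple x; y; z] (comult_l q F))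
    (f' := teval [tuple conv x y; z])) => [c u v|c u v|a b].
- by rewrite (comult_l_lin dl) teval_lin.
- exact: teval_lin.
rewrite comult_l_ten // (@teval_tcat 2 1 [tuple x; y] [tuple z]) //.
by rewrite teval1_ten // teval_ten // !big_ord_recl big_ord0 mulr1.
Qed.

Lemma teval_comult_r F :
  teval [tuple x; y; z] (comult_r q F) = teval [tuple x; conv y z] F.
Proof.
have cl : forall i, scalar (tnth [tuple x; conv y z] i).
  by apply: tuple2P => //; apply: conv_lin.
move: F; apply: (tpow2_ext (V := k^o)
    (f := fun F => teval [tuple x; y; z] (comult_r q F))
    (f' := teval [tuple x; conv y z])) => [c u v|c u v|a b].
- by rewrite (comult_r_lin dl) teval_lin.
- exact: teval_lin.
rewrite comult_r_ten // (@teval_tcat 1 2 [tuple x] [tuple y; z]) //.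
by rewrite teval1_ten // teval_ten // !big_ord_recl big_ord0 mulr1.
Qed.

End Convolution.

(** Evaluating the associator of the twist at (x, y, z): the factors built from F
    and its inverse become the coboundary of J(x, y) = (x ox y)(F), so a trivial
    twisted associator means that this coboundary cancels the values of the
    original one. *)
Lemma twist_coboundary (q : qbialg A) (F Fi : tpow A 2) x y z xy yz :
  linear (comult q) -> F * Fi = 1 -> coassoc (twist q F Fi) = 1 ->
  is_character x -> is_character y -> is_character z ->
  is_character xy -> is_character yz ->
  conv q x y =1 xy -> conv q y z =1 yz ->
  teval [tuple y; z] F * teval [tuple x; yz] F * teval [tuple x; y; z] (coassoc q)
  = teval [tuple xy; z] F * teval [tuple x; y] F.
Proof.
move=> dl FFi /(congr1 (teval [tuple x; y; z])) E xc yc zc xyc yzc.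
move=> /funext xyE /funext yzE.
have [xl x1 _] := xc; have [yl _ _] := yc; have [zl z1 _] := zc.
have c3 := tuple3P xc yc zc.
have l3 := tuple3P (P := fun x => scalar x) xl yl zl.
have Vt u v : is_character u -> is_character v ->
    teval [tuple u; v] F * teval [tuple u; v] Fi = 1.
  move=> uc vc; have c2 := tuple2P uc vc.
  by rewrite -tevalM // FFi teval1.
move: E; rewrite teval1 // /twist /= !tevalM // teval_comult_l // teval_comult_r //.
rewrite xyE yzE.
rewrite (@teval_tcat 1 2 [tuple x] [tuple y; z]) //.
rewrite (@teval_tcat 2 1 [tuple x; y] [tuple z]) //.
rewrite (teval1 (X := [tuple x])); last by case=> [[|//] ?].
rewrite (teval1 (X := [tuple z])); last by case=> [[|//] ?].
rewrite mul1r mulr1 => E.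
rewrite -[LHS]mulr1 -(Vt _ _ xyc zc) -[LHS]mulr1 -(Vt _ _ xc yc).
by rewrite -[RHS]mulr1 -E; ring.
Qed.

(** With u_i for [chi i] and r_i = J(u_i, u_1) / J(u_1, u_i), the previous lemma
    gives the associator the value r_(i+1) / r_i at (u_1, u_i, u_1). The product telescopes to r_N / r_0, which
    is 1 as soon as u_N = u_0: this is the invariant that detects the cohomology
    class of a 3-cocycle on a cyclic group. *)
Lemma cyclic_obstruction (q : qbialg A) (F Fi : tpow A 2) (chi : nat -> A -> k) N :
  linear (comult q) -> F * Fi = 1 -> coassoc (twist q F Fi) = 1 ->
  (forall i, is_character (chi i)) ->
  (forall i j, conv q (chi i) (chi j) =1 chi (i + j)%N) -> chi N = chi 0%N ->
  \prod_(i < N) teval [tuple chi 1%N; chi i; chi 1%N] (coassoc q) = 1.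
Proof.
move=> dl FFi E chic chiD chiN.
pose J i j := teval [tuple chi i; chi j] F.
have J0 i j : J i j != 0.
  have c2 := tuple2P (chic i) (chic j).
  apply/eqP => J0; have := teval1 c2; rewrite -FFi tevalM // -/(J i j) J0 mul0r.
  by move/eqP; rewrite eq_sym oner_eq0.
have step i : teval [tuple chi 1%N; chi i; chi 1%N] (coassoc q) =
    (J i.+1 1%N / J 1%N i.+1) / (J i 1%N / J 1%N i).
  have chi_i1 : conv q (chi i) (chi 1%N) =1 chi i.+1 by rewrite -[i.+1]addn1.
  have H := twist_coboundary dl FFi E (chic 1%N) (chic i) (chic 1%N)
    (chic i.+1) (chic i.+1) (chiD 1%N i) chi_i1.
  apply: (mulfI (mulf_neq0 (J0 i 1%N) (J0 1%N i.+1))); rewrite H /J; field.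
  by rewrite !J0.
under eq_bigr => i _ do rewrite step.
rewrite -(big_mkord xpredT (fun i => (J i.+1 1%N / J 1%N i.+1) / (J i 1%N / J 1%N i))).
case: N chiN => [|N] chiN; first by rewrite big_geq.
rewrite telescope_prodf // => [|i _]; last by rewrite mulf_neq0 ?invr_neq0.
by rewrite /J chiN divff // mulf_neq0 ?invr_neq0 ?J0.
Qed.

End Characters.

(** * Commutative quasi-Hopf algebras and genuineness *)

(** An isomorphism carries the trivial associator of K to the associator of the
    twist of H. *)
Lemma twist_trivial_of_hopf (k : fieldType) (H K : quasi_hopf k) :
  is_hopf K -> gauge_equivalent H K ->
  exists F Fi : tpow H 2, F * Fi = 1 /\ coassoc (twist (qh_struct H) F Fi) = 1.
Proof.
case=> K1 _ _ [F [Fi [FFi _ _ _ [f [_ _ _ E]]]]].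
by exists F, Fi; split => //; rewrite E K1 tmap1.
Qed.

Section Commutative.
Variables (k : fieldType) (H : quasi_hopf k).
Hypothesis HC : commutative (@GRing.mul H).
Local Notation Q := (qh_struct H).
Local Notation S := (@qh_antipode k H).
Local Notation alpha := (qh_alpha H).
Local Notation beta := (qh_beta H).
Let ax := qh_bialg_ax H.
Let Sax := qh_antipode_ax H.
Let tC n := tpow_comm (n := n) HC.
Let Sl : linear S := antipode_lin Sax.

(** What a twist of H with trivial associator must be: conjugation by F is the
    identity in a commutative algebra, so the coproduct does not change. *)
Definition untwisted : qbialg H := QBialg (comult Q) (counit Q) 1.

Lemma tlift_mull n (b : H) (f f' : n.-tuple H -> H) t :
  (forall p, f' p = b * f p) -> tlift f' t = b * tlift f t.
Proof.
move=> E; rewrite /tlift /evalsum mulr_sumr; apply: eq_bigr => cp _.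
by rewrite E -scalerAr.
Qed.

(** By commutativity alpha and beta factor out of the axiom relating them to the
    associator, so both are invertible; dividing by them turns the quasi-antipode
    into an antipode, as in [antipode_l] and [antipode_r]. *)
Lemma alpha_beta_unit : exists c, c * (alpha * beta) = 1.
Proof.
exists (lift3 (fun x y z => x * S y * z) (coassoc Q)).
rewrite HC -[RHS](antipode_coassoc Sax); apply/esym/tlift_mull => p /=.
rewrite mulrA [_ * alpha]HC -!mulrA; congr (_ * _).
by rewrite !mulrA [_ * beta]HC.
Qed.

Lemma antipode_l a : lift2 (fun x y => S x * 1 * y) (comult Q a) = counit Q a *: 1.
Proof.
have [c cab] := alpha_beta_unit.
have ca : c * beta * alpha = 1 by rewrite -mulrA [beta * _]HC.
rewrite -[in RHS]ca scalerAr -(antipode_alpha Sax); apply: tlift_mull => p /=.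
by rewrite mulr1 [_ * alpha]HC !mulrA ca mul1r.
Qed.

Lemma antipode_r a : lift2 (fun x y => x * 1 * S y) (comult Q a) = counit Q a *: 1.
Proof.
have [c cab] := alpha_beta_unit.
have cb : c * alpha * beta = 1 by rewrite -mulrA.
rewrite -[in RHS]cb scalerAr -(antipode_beta Sax); apply: tlift_mull => p /=.
by rewrite mulr1 [_ * beta]HC !mulrA cb mul1r.
Qed.

(** In a commutative algebra the associator cancels from the quasi-coassociativity
    axiom, so the coproduct is coassociative. *)
Lemma untwisted_is_quasi_bialgebra : is_quasi_bialgebra untwisted.
Proof.
case: ax => dl d1 dM el e1 eM ecl ecr [psi [cp pc]] qc pent cc.
split => //=.
- by exists 1; rewrite !mulr1.
- move=> a; have := congr1 (fun t => t * psi) (qc a).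
  by rewrite [coassoc Q * _]tC -!mulrA cp !mulr1 mul1r.
- rewrite -ten3_1 comult_rr_ten // comult_ll_ten // comult_mm_ten //=.
  rewrite d1 ten3_1 ten2_1 ten1_1.
  rewrite (tcat11 H 2 1) (tcat11 H 2 2) (tcat11 H 1 3) (tcat11 H 3 1).
  by rewrite !mulr1.
by rewrite -ten3_1 counit_m_ten // e1 scale1r ten2_1.
Qed.

Lemma untwisted_is_quasi_antipode : is_quasi_antipode untwisted S 1 1.
Proof.
have [c cab] := alpha_beta_unit.
have [_ S1 SM _ _ _ _] := Sax.
have ml (b : H) (f : H -> H) : linear f -> linear (fun a => f a * b).
  by move=> fl d u v; rewrite fl mulrDl scalerAl.
have mr (b : H) (f : H -> H) : linear f -> linear (fun a => b * f a).
  by move=> fl d u v; rewrite fl mulrDr scalerAr.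
have idl : linear (fun a : H => a) by [].
split => //; [exact: antipode_l | exact: antipode_r | |].
  rewrite /= -ten3_1 lift3_ten ?S1 ?mulr1 // => ? ?.
  - by do 4!apply/ml.
  - by do 2!apply/ml; apply/mr.
  - by apply/mr.
move=> psi; rewrite mul1r => -> _; rewrite -ten3_1 lift3_ten ?S1 ?mulr1 // => ? ?.
- by do 4!apply/ml.
- by do 2!apply/ml; apply/mr.
- by apply/mr.
Qed.

Definition untwisted_hopf : quasi_hopf k :=
  QuasiHopf untwisted_is_quasi_bialgebra untwisted_is_quasi_antipode.

Lemma twist_trivial_gauge F Fi :
  F * Fi = 1 -> counit_l Q F = 1 -> counit_r Q F = 1 ->
  coassoc (twist Q F Fi) = 1 -> gauge_equivalent H untwisted_hopf.
Proof.
move=> FFi Fl Fr E; exists F, Fi; split; rewrite // 1?tC //.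
exists (idfun : {lrmorphism H -> H}); split => // [|a|]; first by exists id.
  by rewrite tmap_id /= [F * _]tC -mulrA FFi mulr1.
by rewrite E (tmap1 (idfun : {lrmorphism H -> H})).
Qed.

End Commutative.

(** * Twisted doubles: commutativity and block-diagonal twists *)

Section SymmetricCocycle.
Variables (k : fieldType) (G : finGroupType) (w : cocycle3 k G).
Hypothesis GC : forall x y : G, (x * y = y * x)%g.
Hypothesis wS : forall x y z, w x y z = w x z y.

Lemma conjg_abelian (x y : G) : (x ^ y)%g = x.
Proof. by rewrite conjgE GC mulgK. Qed.

Lemma theta_symE x y z : theta w x y z = w x y z.
Proof. by rewrite /theta !conjg_abelian (wS y x z) mulfK ?cocycle3_neq0. Qed.

Lemma gamma_symE x y z : gamma w x y z = w x y z.
Proof. by rewrite /gamma !conjg_abelian (wS y z x) [w y x z * _]mulrC mulfK ?cocycle3_neq0. Qed.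

Lemma tqd_comm : commutative (@GRing.mul (tqd w)).
Proof.
move=> u v; move: u; apply: tqd_ext => [c a b|c a b|h x].
- by rewrite mulrDl scalerAl.
- by rewrite mulrDr scalerAr.
move: v; apply: tqd_ext => [c a b|c a b|l y].
- by rewrite mulrDr scalerAr.
- by rewrite mulrDl scalerAl.
rewrite !tqdE_M !conjg_abelian eq_sym; case: eqP => // ->.
by rewrite !theta_symE wS GC.
Qed.

End SymmetricCocycle.

Section Diagonal.
Variables (k : fieldType) (G : finGroupType) (w : cocycle3 k G).
Local Notation D := (tqd w).
Local Notation E := (tqdE w).
Local Notation Q := (tqd_struct w).

(** Elements of the tensor power whose first leg lies in the span of the
    orthogonal idempotents e(h) ox 1. On these, multiplication is computed block
    by block ([diagM]), which reduces an identity in the (n+1)-st tensor power to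
    identities in the n-th one. *)
Definition diag n (X : G -> tpow D n) : tpow D n.+1 :=
  \sum_h (tcat (ten [tuple E h 1%g]) (X h) : tpow D n.+1).

Lemma ten_unit_M h l : ten [tuple E h 1%g] * ten [tuple E l 1%g] =
  if h == l then ten [tuple E h 1%g] else 0.
Proof.
have -> : ten [tuple E h 1%g] * ten [tuple E l 1%g] = ten [tuple E h 1%g * E l 1%g].
  by rewrite tenM; congr ten; apply: eq_from_tnth => -[[|//] ?]; rewrite tnth_mktuple.
rewrite tqdE_M conjg1 theta_1r scale1r mulg1; case: eqP => // _.
exact: (plin0 (@ten1_lin k D)).
Qed.

Lemma diagM n (X Y : G -> tpow D n) : diag X * diag Y = diag (fun h => X h * Y h).
Proof.
rewrite /diag mulr_suml; apply: eq_bigr => h _; rewrite mulr_sumr.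
have M l : (tcat (ten [tuple E h 1%g]) (X h) : tpow D n.+1) *
    tcat (ten [tuple E l 1%g]) (Y l) =
    tcat (if h == l then ten [tuple E h 1%g] else 0) (X h * Y l).
  by rewrite -ten_unit_M -tcatM.
rewrite (bigD1 h) //= big1 ?addr0 => [|l lh]; first by rewrite M eqxx.
by rewrite M eq_sym (negPf lh) (plin0 (tcat_linear_l _)).
Qed.

Lemma sum_unit : \sum_h ten [tuple E h 1%g] = 1.
Proof.
rewrite -ten1_1 -[in RHS]tqdF1_1 (plin_sum (@ten1_lin k D)).
by apply: eq_bigr => h _; rewrite scale1r.
Qed.

Lemma diag_cst n (X : tpow D n) : diag (fun=> X) = tcat (1 : tpow D 1) X.
Proof. by rewrite -sum_unit (plin_sum (tcat_linear_l X)). Qed.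

Lemma diag1 n : diag (fun=> 1 : tpow D n) = 1.
Proof. by rewrite diag_cst; exact: (tcat11 _ 1 n). Qed.

Lemma eq_diag n (X Y : G -> tpow D n) : X =1 Y -> diag X = diag Y.
Proof. by move=> XY; apply: eq_bigr => h _; rewrite XY. Qed.

(** For a homomorphism W from G to the units of D, this is the bicharacter-like
    twist whose value at (x, y) is y (W h), h being the component of x in G. *)
Definition partial_twist (W : G -> D) : tpow D 2 :=
  diag (fun h => ten [tuple W h]).

Lemma partial_twistE W : partial_twist W = \sum_h ten [tuple E h 1%g; W h].
Proof. by apply: eq_bigr => h _; rewrite tcat_ten; congr ten; apply: val_inj. Qed.

Lemma counit_l_partial W : counit_l Q (partial_twist W) = W 1%g.
Proof.
have el := @tqd_counit_lin k G w.
rewrite partial_twistE (plin_sum (counit_l_lin (q := Q) el)) (bigD1 1%g) //=.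
rewrite big1 ?addr0 => [|h h1]; rewrite (counit_l_ten (q := Q) el) /= tqd_counit_E.
  by rewrite eqxx scale1r.
by rewrite (negPf h1) scale0r.
Qed.

Lemma counit_r_partial W : (forall h, tqd_counit (W h) = 1) ->
  counit_r Q (partial_twist W) = 1.
Proof.
move=> W1; have el := @tqd_counit_lin k G w.
rewrite partial_twistE (plin_sum (counit_r_lin (q := Q) el)) -tqdF1_1.
by apply: eq_bigr => h _; rewrite (counit_r_ten (q := Q) el) /= W1.
Qed.

Lemma comult_r_partial W :
  comult_r Q (partial_twist W) = diag (fun h => tqd_comult (W h)).
Proof.
have cl := @tqd_comult_lin k G w.
rewrite partial_twistE (plin_sum (comult_r_lin (q := Q) cl)).
by apply: eq_bigr => h _; rewrite (comult_r_ten (q := Q) cl).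
Qed.

(** Delta (e(h) ox 1) is the sum of the e(l) ox 1 ox e(l') ox 1 with l l' = h. *)
Lemma comult_l_partial W :
  comult_l Q (partial_twist W) = diag (fun l => partial_twist (fun h => W (l * h)%g)).
Proof.
have cl := @tqd_comult_lin k G w.
rewrite partial_twistE (plin_sum (comult_l_lin (q := Q) cl)).
under eq_bigr => h _ do
  rewrite (comult_l_ten (q := Q) cl) (lin_comult_E _ _ (tcat_linear_l _)).
rewrite exchange_big; apply: eq_bigr => l _ /=.
rewrite (reindex_inj (mulgI l)) /= partial_twistE (plin_sum (tcat_linear_r _)).
apply: eq_bigr => h _; rewrite mulKg gamma_1 scale1r !tcat_ten.
by congr ten; apply: val_inj.
Qed.

Lemma tcat_partial_1 W :
  tcat (partial_twist W) (1 : tpow D 1) = diag (fun h => ten [tuple W h; 1]).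
Proof.
rewrite partial_twistE (plin_sum (tcat_linear_l _)); apply: eq_bigr => h _.
by rewrite -ten1_1 !tcat_ten; congr ten; apply: val_inj.
Qed.

Lemma ten1_partial W b :
  ten [tuple 1; b] * partial_twist W = partial_twist (fun h => b * W h).
Proof.
rewrite !partial_twistE mulr_sumr; apply: eq_bigr => h _.
by rewrite ten2M mul1r.
Qed.

Hypothesis DC : commutative (@GRing.mul D).
Let tC n := tpow_comm (n := n) DC.

Variables (W : G -> D) (R R' : G -> tpow D 2).
Hypothesis W1 : W 1%g = 1.
Hypothesis WM : forall h l, W (h * l)%g = W h * W l.
Hypothesis W_comult : forall h, tqd_comult (W h) = ten [tuple W h; W h] * R h.
Hypothesis R_inv : forall h, R h * R' h = 1.
Hypothesis coassoc_diag : coassoc Q = diag R'.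
Local Notation Wi := (fun h => W h^-1%g).
Local Notation F := (partial_twist W).
Local Notation Fi := (partial_twist Wi).

Let WV h : W h * W h^-1%g = 1. Proof. by rewrite -WM mulgV. Qed.

Lemma partial_twistK : F * Fi = 1.
Proof.
rewrite diagM -[RHS]diag1; apply: eq_diag => h.
rewrite -ten1_1 -(WV h) tenM; congr ten.
by apply: eq_from_tnth => -[[|//] ?]; rewrite tnth_mktuple.
Qed.

(** In the block of h, multiplicativity of W makes (Delta ox id)(F) contribute
    W h ox 1 and 1 ox W h, and these cancel the part W h ox W h of
    (id ox Delta)(F). What is left of the latter is the defect R h of W h from
    being group-like, and the associator supplies its inverse. *)
Lemma partial_twist_trivial : coassoc (twist Q F Fi) = 1.
Proof.
rewrite [LHS](_ : _ = tcat (1 : tpow D 1) F * comult_r Q F * coassoc Q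
  * comult_l Q Fi * tcat Fi (1 : tpow D 1)) // coassoc_diag.
rewrite -diag_cst comult_r_partial comult_l_partial.
rewrite tcat_partial_1 !diagM -[RHS]diag1; apply: eq_diag => h.
have -> : partial_twist (fun l => W (h * l)^-1%g) = ten [tuple 1; W h^-1%g] * Fi.
  rewrite ten1_partial; apply: eq_diag => l.
  by rewrite invMg WM [_ * W h^-1%g]DC.
have TT : ten [tuple W h; W h] * (ten [tuple 1; W h^-1%g] * ten [tuple W h^-1%g; 1]) = 1.
  by rewrite !ten2M mul1r mulr1 WV ten2_1.
rewrite W_comult -[RHS]TT -[in RHS](mul1r (ten [tuple W h; W h])) -partial_twistK.
have CA (x y z : tpow D 2) : x * (y * z) = y * (x * z).
  by rewrite mulrA [x * y]tC -mulrA.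
rewrite [_ * R h]tC -!mulrA; congr (F * _).
rewrite (CA _ (R' h)) (mulrA (R h)) R_inv mul1r.
by rewrite (CA _ Fi) (CA _ Fi).
Qed.

End Diagonal.

(** * The double of a cyclic group *)

Section Cyclic.
Variables (k : fieldType) (m a : nat) (G : finGroupType) (g : G).
Hypotheses (G_gen : [set: G] = <[g]>%g) (g_order : #[g]%g = m) (m_gt1 : (1 < m)%N).
Implicit Types h l x y : G.

Let m_gt0 : (0 < m)%N. Proof. exact: ltnW. Qed.

Definition dlog h : nat := index h (mkseq (fun i => g ^+ i)%g m).
Definition carry h l : nat := (dlog h + dlog l) %/ m.

Let powers_size : size (mkseq (fun i => g ^+ i)%g m) = m.
Proof. exact: size_mkseq. Qed.

Let mem_powers h : h \in mkseq (fun i => g ^+ i)%g m.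
Proof.
have /cycleP[i ->] : h \in <[g]>%g by rewrite -G_gen inE.
apply/mapP; exists (i %% m)%N; first by rewrite mem_iota ltn_mod.
by rewrite -g_order expg_mod_order.
Qed.

Lemma dlog_lt h : (dlog h < m)%N.
Proof. by rewrite -[X in (_ < X)%N]powers_size index_mem. Qed.

Lemma expg_dlog h : (g ^+ dlog h)%g = h.
Proof. by have := nth_index 1%g (mem_powers h); rewrite nth_mkseq ?dlog_lt. Qed.

Lemma dlog_expg n : dlog (g ^+ n)%g = (n %% m)%N.
Proof.
have := expg_dlog (g ^+ n)%g; move/eqP; rewrite eq_expg_mod_order g_order => /eqP.
by rewrite modn_small // dlog_lt.
Qed.

Lemma dlogM h l : (dlog h + dlog l = carry h l * m + dlog (h * l)%g)%N.
Proof.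
by rewrite {1}(divn_eq (dlog h + dlog l) m) -dlog_expg expgD !expg_dlog.
Qed.

Lemma cyclicC h l : (h * l = l * h)%g.
Proof. by rewrite -(expg_dlog h) -(expg_dlog l) -!expgD addnC. Qed.

Lemma carryC h l : carry h l = carry l h.
Proof. by rewrite /carry addnC. Qed.

Lemma dlog1 : dlog 1%g = 0%N.
Proof. by rewrite -(expg0 g) dlog_expg mod0n. Qed.

Lemma dlog_gen : dlog g = 1%N.
Proof. by rewrite -[g in dlog g]expg1 dlog_expg modn_small. Qed.

(** The carry is the coboundary of the integer part of n / m; this is what makes
    [chi_genD] and the telescoping sum [sum_carry] work. *)
Lemma carry_expg n p : ((n + p) %/ m = n %/ m + p %/ m + carry (g ^+ n) (g ^+ p)%g)%N.
Proof.
rewrite /carry !dlog_expg {1}(divn_eq n m) {1}(divn_eq p m).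
by rewrite addnACA -mulnDl divnMDl.
Qed.

Lemma carry_gen n : (n.+1 %/ m = n %/ m + carry (g ^+ n)%g g)%N.
Proof. by rewrite -[n.+1]addn1 carry_expg (divn_small m_gt1) addn0 expg1. Qed.

Variables (zeta : k) (w : cocycle3 k G).
Hypothesis zetam : zeta ^+ m = 1.
Hypothesis w_def : forall i j l : nat, (i < m)%N -> (j < m)%N -> (l < m)%N ->
  w (g ^+ i)%g (g ^+ j)%g (g ^+ l)%g = zeta ^+ (a * i * ((j + l) %/ m)).
Local Notation D := (tqd w).
Local Notation E := (tqdE w).
Local Notation Q := (tqd_struct w).

Lemma wE h l x : w h l x = zeta ^+ (a * dlog h * carry l x).
Proof. by rewrite -w_def ?dlog_lt // !expg_dlog. Qed.

Lemma zeta_mod n p : n = p %[mod m] -> zeta ^+ n = zeta ^+ p.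
Proof. by move=> np; rewrite -(expr_mod n zetam) np expr_mod. Qed.

Lemma w_expg n l x : w (g ^+ n)%g l x = zeta ^+ (a * n * carry l x).
Proof.
rewrite wE dlog_expg; apply: zeta_mod.
by rewrite -(modnMml (a * (n %% m))) modnMmr modnMml.
Qed.

Lemma w_sym h l x : w h l x = w h x l.
Proof. by rewrite !wE carryC. Qed.

Let thE h x y : theta w h x y = w h x y.
Proof. exact: (theta_symE cyclicC w_sym). Qed.
Let gaE h x y : gamma w h x y = w h x y.
Proof. exact: (gamma_symE cyclicC w_sym). Qed.
Let cj h x : (h ^ x)%g = h.
Proof. exact: (conjg_abelian cyclicC). Qed.

Lemma tqd_cyclic_comm : commutative (@GRing.mul D).
Proof. exact: (tqd_comm cyclicC w_sym). Qed.

Let zeta0 : zeta != 0.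
Proof. by apply/eqP => z0; have /eqP := zetam; rewrite z0 expr0n gtn_eqF // eq_sym oner_eq0. Qed.

Variable xi : k.
Hypothesis xim : xi ^+ m = zeta ^+ a.

Let xi0 : xi != 0.
Proof.
apply/eqP => z0; have /eqP := xim.
by rewrite z0 expr0n gtn_eqF // eq_sym expf_eq0 (negPf zeta0) andbF.
Qed.

Section Obstruction.

(** The value c of the n-th power (n mod m, c) of the character (1, xi): one
    factor z ^ a is picked up at each passage of the exponent through a multiple
    of m. *)
Definition chi_gen n : k := xi ^+ n * zeta ^+ (a * (n %/ m)).

Definition chi n (u : D) : k :=
  \sum_p u p * ((p.1 == g ^+ n)%g%:R * chi_gen n ^+ dlog p.2).

Lemma chi_lin n : scalar (chi n).
Proof.
exact: (tqd_sum_lin (V := k^o) (fun p => (p.1 == g ^+ n)%g%:R * chi_gen n ^+ dlog p.2)).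
Qed.

Lemma chi_E n h x : chi n (E h x) = (h == g ^+ n)%g%:R * chi_gen n ^+ dlog x.
Proof.
exact: (tqd_sumE w (V := k^o) (fun p => (p.1 == g ^+ n)%g%:R * chi_gen n ^+ dlog p.2)).
Qed.

Lemma chi_genX n : chi_gen n ^+ m = zeta ^+ (a * n).
Proof.
have zX j : (zeta ^+ j) ^+ m = 1 by rewrite exprAC zetam expr1n.
by rewrite /chi_gen exprMn zX mulr1 exprAC xim exprM.
Qed.

Lemma chi_genD n p :
  chi_gen (n + p) = zeta ^+ (a * carry (g ^+ n) (g ^+ p)%g) * (chi_gen n * chi_gen p).
Proof. by rewrite /chi_gen carry_expg !mulnDr !exprD; ring. Qed.

Lemma chi_character n : is_character (chi n).
Proof.
split; first exact: chi_lin.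
  rewrite -tqdF1_1 (plin_sum (V := k^o) (chi_lin n)) (bigD1 (g ^+ n)%g) //=.
  rewrite scale1r chi_E eqxx dlog1 mulr1 big1 ?addr0 // => h hn.
  by rewrite scale1r chi_E (negPf hn) mul0r.
move=> u v.
move: u; apply: (tqd_ext (V := k^o) (f := fun u => chi n (u * v))
    (f' := fun u => chi n u * chi n v)) => [c s t|c s t|h x].
- by rewrite mulrDl -scalerAl chi_lin.
- by rewrite chi_lin mulrDl -mulrA.
move: v; apply: (tqd_ext (V := k^o) (f := fun v => chi n (E h x * v))
    (f' := fun v => chi n (E h x) * chi n v)) => [c s t|c s t|l y].
- by rewrite mulrDr -scalerAr chi_lin.
- by rewrite chi_lin mulrDr mulrCA.
rewrite tqdE_M cj thE !chi_E; case: (h =P g ^+ n)%g => [->|hn]; last first.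
  rewrite !mul0r; case: eqP => _; last exact: (plin0 (V := k^o) (chi_lin n)).
  rewrite (plinZ (V := k^o) (chi_lin n)) chi_E; case: eqP => // _.
  by rewrite mul0r scaler0.
rewrite eq_sym; case: eqP => _; last first.
  by rewrite mul0r mulr0 (plin0 (V := k^o) (chi_lin n)).
rewrite (plinZ (V := k^o) (chi_lin n)) chi_E eqxx !mul1r -exprD dlogM exprD.
by rewrite mulnC exprM chi_genX w_expg -exprM.
Qed.

Lemma chi_conv n p : conv Q (chi n) (chi p) =1 chi (n + p).
Proof.
have X_lin : forall i, scalar (tnth [tuple chi n; chi p] i).
  by apply: (tuple2P (P := fun x : D -> k => scalar x)); apply: chi_lin.
have cl : linear (conv Q (chi n) (chi p) : D -> k^o).
  by apply: (conv_lin (q := Q)) => //; [exact: tqd_comult_lin|exact: chi_lin..].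
apply: (tqd_ext (V := k^o) cl (chi_lin _)) => h x.
rewrite /conv /= (lin_comult_E (V := k^o) _ _ (teval_lin X_lin)).
have T l : teval [tuple chi n; chi p] (tqdB2 w l (l^-1 * h)%g x) =
    chi n (E l x) * chi p (E (l^-1 * h)%g x).
  by rewrite teval_ten // !big_ord_recl big_ord0 mulr1.
rewrite (bigD1 (g ^+ n)%g) //= big1 ?addr0 => [|l ln]; last first.
  by rewrite T !chi_E (negPf ln) !mul0r scaler0.
rewrite T !chi_E eqxx mul1r -[X in _ == X](mulKg (g ^+ n)%g) -expgD.
rewrite (inj_eq (mulgI _)); case: eqP => [->|_]; last by rewrite !mul0r mulr0 scaler0.
by rewrite expgD mulKg gaE !mul1r -exprMn chi_genD [in RHS]exprMn -(exprM zeta) wE mulnAC.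
Qed.

Lemma sum_carry n : (\sum_(i < n) carry (g ^+ i)%g g = n %/ m)%N.
Proof.
elim: n => [|n IH]; first by rewrite big_ord0 div0n.
by rewrite big_ord_recr IH carry_gen.
Qed.

(** The hypothesis on n says that the m n-th power of the character (1, xi) is the
    counit; among the m n exponents below that, exactly n produce a carry. *)
Lemma cyclic_double_obstruction (F Fi : tpow D 2) n :
  F * Fi = 1 -> coassoc (twist Q F Fi) = 1 ->
  zeta ^+ (2 * a * n) = 1 -> zeta ^+ (a * n) = 1.
Proof.
move=> FFi Etw zn.
have chiN : chi (m * n) = chi 0.
  have gN : (g ^+ (m * n))%g = (g ^+ 0)%g by rewrite expgM -g_order expg_order expg1n.
  apply/funext => u; rewrite /chi gN /chi_gen div0n mulKn // muln0 !expr0 mulr1.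
  by rewrite exprM xim -exprM -exprD addnn -mul2n mulnA zn.
have := cyclic_obstruction (q := Q) (@tqd_comult_lin k G w) FFi Etw chi_character chi_conv chiN.
have phiE i : teval [tuple chi 1%N; chi i; chi 1%N] (coassoc Q) =
    (zeta ^+ (a * carry (g ^+ i)%g g))^-1.
  have X_lin : forall j, scalar (tnth [tuple chi 1%N; chi i; chi 1%N] j).
    by apply: (tuple3P (P := fun x : D -> k => scalar x)); apply: chi_lin.
  rewrite [coassoc Q]coassoc_F3 (tqdF3_lin (V := k^o) _ _ (teval_lin X_lin)).
  have T x y z : teval [tuple chi 1%N; chi i; chi 1%N] (tqdB3 w x y z 1%g) =
      (x == g)%:R * (y == g ^+ i)%g%:R * (z == g)%:R.
    transitivity (chi 1%N (E x 1%g) * (chi i (E y 1%g) * chi 1%N (E z 1%g))).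
      by rewrite teval_ten // !big_ord_recl big_ord0 mulr1.
    by rewrite !chi_E dlog1 expg1 !mulr1 mulrA.
  rewrite (bigD1 g) //= (bigD1 (g ^+ i)%g) //= (bigD1 g) //=.
  rewrite T !eqxx !mulr1 wE dlog_gen muln1.
  rewrite !big1 ?addr0 ?scaler1 => [|x xg|x xg|x xg]; first exact: mulr1.
  - by rewrite big1 // => y _; rewrite big1 // => z _; rewrite T (negPf xg) !mul0r scaler0.
  - by rewrite big1 // => z _; rewrite T (negPf xg) mulr0 mul0r scaler0.
  - by rewrite T (negPf xg) mulr0 scaler0.
under eq_bigr => i _ do rewrite phiE.
rewrite prodfV prodrXr -big_distrr /= sum_carry mulKn //.
by move=> /eqP; rewrite invr_eq1 => /eqP.
Qed.

End Obstruction.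

Section Trivialization.

(** Its value at the character (i, xi ^ i z ^ s) is z ^ s: it is the coordinate of
    a character in the fibre over its component in Z_m. *)
Definition fibre_coord : D := tqdF1 w (fun h => xi ^- dlog h) g.

(** In the block of h the powers of e(h) ox g pick up the factor w(h, g^i, g),
    which is z ^ (a dlog h) when i + 1 is a multiple of m and 1 otherwise. *)
Lemma fibre_coordX n : fibre_coord ^+ n =
  tqdF1 w (fun h => xi ^- (n * dlog h) * zeta ^+ (a * dlog h * (n %/ m))) (g ^+ n)%g.
Proof.
elim: n => [|n IH].
  rewrite expr0 -tqdF1_1; apply: eq_F1 => h.
  by rewrite mul0n div0n muln0 expr0 invr1 mulr1.
rewrite exprSr IH tqdF1_M expgSr; apply: eq_F1 => h.
rewrite cj thE wE carry_gen mulnDr exprD mulSn exprD invfM.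
by ring.
Qed.

Lemma fibre_coord_order : fibre_coord ^+ m = 1.
Proof.
rewrite fibre_coordX -g_order expg_order g_order -tqdF1_1; apply: eq_F1 => h.
by rewrite divnn m_gt0 muln1 exprM xim -exprM mulVf // expf_neq0.
Qed.

Definition carry_tensor n : tpow D 2 := tqdF2 w (fun h l => zeta ^+ (n * carry h l)) 1%g.

Lemma carry_tensorD n p : carry_tensor n * carry_tensor p = carry_tensor (n + p).
Proof.
rewrite /carry_tensor tqdF2_M mulg1; apply: eq_F2 => h l.
by rewrite !cj !theta_1r !mulr1 mulnDl exprD.
Qed.

Lemma carry_tensor_mod n p : n = p %[mod m] -> carry_tensor n = carry_tensor p.
Proof.
move=> np; apply: eq_F2 => h l; apply: zeta_mod.
by rewrite -modnMml np modnMml.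
Qed.

Lemma carry_tensor0 : carry_tensor 0 = 1.
Proof. by rewrite -tqdF2_1; apply: eq_F2 => h l; rewrite mul0n. Qed.

Lemma carry_tensorX n i : carry_tensor n ^+ i = carry_tensor (i * n).
Proof.
elim: i => [|i IH]; first by rewrite expr0 mul0n carry_tensor0.
by rewrite exprS IH carry_tensorD mulSn.
Qed.

(** One carry in the exponent of xi gives a factor xi ^ m = z ^ a, and gamma gives
    another one: hence 2 a, which is where the parity condition comes from. *)
Lemma comult_fibre_coord :
  tqd_comult fibre_coord = ten [tuple fibre_coord; fibre_coord] * carry_tensor (2 * a).
Proof.
have -> : ten [tuple fibre_coord; fibre_coord] =
    tqdF2 w (fun h l => xi ^- dlog h * xi ^- dlog l) g.
  rewrite {1}/fibre_coord (plin_sum (ten2_lin1 _)); apply: eq_bigr => h _.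
  rewrite (plinZ (ten2_lin1 _)) (plin_sum (ten2_lin2 _)) scaler_sumr.
  by apply: eq_bigr => l _; rewrite (plinZ (ten2_lin2 _)) scalerA.
rewrite tqd_comult_F1 tqdF2_M mulg1; apply: eq_F2 => h l.
rewrite !theta_1r !cj gaE wE dlog_gen muln1 !mulr1 -invfM -exprD dlogM exprD.
rewrite [(carry h l * m)%N]mulnC (exprM xi) xim -exprM mul2n -addnn mulnDl exprD.
by field; rewrite !expf_neq0.
Qed.

Variable t : nat.
Hypothesis tE : 2 * a * t = a %[mod m].

Definition fibre_power h : D := (fibre_coord ^+ t) ^+ dlog h.

(** The exponents add up only modulo m, which suffices because [fibre_coord] ^ m
    is 1. *)
Lemma fibre_powerM h l : fibre_power (h * l)%g = fibre_power h * fibre_power l.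
Proof.
rewrite /fibre_power -exprD dlogM exprD [(carry h l * m)%N]mulnC.
rewrite [in X in X * _]exprM -(exprM _ t m) mulnC (exprM _ m t).
by rewrite fibre_coord_order !expr1n mul1r.
Qed.

Lemma comult_fibre_power h :
  tqd_comult (fibre_power h) = ten [tuple fibre_power h; fibre_power h] * carry_tensor (a * dlog h).
Proof.
have d1 : tqd_comult (1 : D) = 1 := comult1 (tqd_is_quasi_bialgebra w).
have dM (u v : D) : tqd_comult (u * v) = tqd_comult u * tqd_comult v.
  exact: comultM (tqd_is_quasi_bialgebra w) u v.
have dX (u : D) n : tqd_comult (u ^+ n) = tqd_comult u ^+ n.
  elim: n => [|n IH]; first by rewrite !expr0 d1.
  by rewrite !exprS dM IH.
have tX (u : D) n : ten [tuple u; u] ^+ n = ten [tuple u ^+ n; u ^+ n].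
  elim: n => [|n IH]; first by rewrite !expr0 ten2_1.
  by rewrite !exprS IH ten2M.
rewrite /fibre_power !dX comult_fibre_coord !exprMn_comm; last exact: tpow_comm tqd_cyclic_comm _ _.
  rewrite !tX !carry_tensorX; congr (_ * _); apply: carry_tensor_mod.
  by rewrite -modnMmr [(t * _)%N]mulnC tE modnMmr mulnC.
exact: tpow_comm tqd_cyclic_comm _ _.
Qed.

(** The exponent is - a dlog h modulo m, made nonnegative by adding a multiple
    of m. *)
Lemma coassoc_carry :
  coassoc Q = diag (fun h => carry_tensor (m * a * dlog h - a * dlog h)).
Proof.
rewrite [coassoc Q]coassoc_F3; apply: eq_bigr => h _.
rewrite /carry_tensor (tqdF2_lin _ _ (@tcat_linear_r k D 1 2 _)).
apply: eq_bigr => l _; apply: eq_bigr => x _; rewrite tcat_ten.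
congr (_ *: _); last by congr ten; apply: val_inj.
apply: (mulIf (expf_neq0 (a * dlog h * carry l x) zeta0)).
rewrite -wE mulVf ?cocycle3_neq0 // wE -exprD -mulnDl subnK; last first.
  by rewrite leq_mul // leq_pmull.
by rewrite -!mulnA exprM zetam expr1n.
Qed.

Lemma counit_fibre_power h : tqd_counit (fibre_power h) = 1.
Proof.
have e1 : tqd_counit (1 : D) = 1 := counit1 (tqd_is_quasi_bialgebra w).
have eM (u v : D) : tqd_counit (u * v) = tqd_counit u * tqd_counit v.
  exact: counitM (tqd_is_quasi_bialgebra w) u v.
have eX (u : D) n : tqd_counit (u ^+ n) = tqd_counit u ^+ n.
  elim: n => [|n IH]; first by rewrite !expr0 e1.
  by rewrite !exprS eM IH.
by rewrite !eX tqd_counit_F1 dlog1 expr0 invr1 !expr1n.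
Qed.

(** Put V = fibre_coord ^ t. By the choice of t, the defect of V^i from being
    group-like is [carry_tensor] (a i), the inverse of the block of the associator
    at g^i. *)
Lemma cyclic_double_not_genuine : ~ genuine (twisted_double w).
Proof.
have DC := tqd_cyclic_comm.
have fibre_power1 : fibre_power 1%g = 1 by rewrite /fibre_power dlog1.
have R_inv h : carry_tensor (a * dlog h) * carry_tensor (m * a * dlog h - a * dlog h) = 1.
  rewrite carry_tensorD subnKC; last by rewrite leq_mul // leq_pmull.
  by rewrite -carry_tensor0; apply: carry_tensor_mod; rewrite -mulnA modnMr mod0n.
move=> gen; apply: (gen (untwisted_hopf (H := twisted_double w) DC)) => //.
apply: (twist_trivial_gauge (H := twisted_double w) DC
  (F := partial_twist fibre_power) (Fi := partial_twist (fun h => fibre_power h^-1%g))).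
- exact: (partial_twistK fibre_power1 fibre_powerM).
- by rewrite counit_l_partial.
- exact/counit_r_partial/counit_fibre_power.
- exact: (partial_twist_trivial DC fibre_power1 fibre_powerM comult_fibre_power
    R_inv coassoc_carry).
Qed.

End Trivialization.
End Cyclic.

(** * Arithmetic of the exponents *)

Lemma exists_root_of (k : closedFieldType) (c : k) m : (0 < m)%N -> exists x, x ^+ m = c.
Proof.
move=> m0; have /closed_rootP[x] : size ('X^m - c%:P) != 1%N.
  by rewrite size_XnsubC // eqSS -lt0n.
by rewrite rootE !hornerE subr_eq0 => /eqP; exists x.
Qed.

(** The Bezout relation for 2a and m, multiplied by a / (m, 2a). *)
Lemma halvable_mod m a : (0 < a)%N -> (gcdn m (2 * a) %| a)%N ->
  exists t, 2 * a * t = a %[mod m].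
Proof.
move=> a0 /dvdnP[q aE]; have a20 : (0 < 2 * a)%N by rewrite muln_gt0.
have [u v uv _] := egcdnP m a20.
exists (u * q)%N; rewrite mulnA [(2 * a * u)%N]mulnC uv mulnDl gcdnC.
by rewrite [(gcdn _ _ * q)%N]mulnC -aE mulnAC modnMDl.
Qed.

(** * The criterion *)

Theorem theorem1p2 (k : closedFieldType) (char_k : [pchar k] =i pred0)
    (m a : nat) (G : finGroupType) (g : G)
    (G_gen : [set: G] = <[g]>%g) (g_order : #[g]%g = m)
    (a_bounds : (1 <= a < m)%N)
    (zeta : k) (zeta_prim : m.-primitive_root zeta)
    (w : cocycle3 k G)
    (w_def : forall i j l : nat, (i < m)%N -> (j < m)%N -> (l < m)%N ->
       w (g ^+ i)%g (g ^+ j)%g (g ^+ l)%g = zeta ^+ (a * i * ((j + l) %/ m))) :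
  genuine (twisted_double w) <-> ~~ (gcdn m (2 * a) %| gcdn m a)%N.
Proof.
have [a0 am] := andP a_bounds; have m1 : (1 < m)%N := leq_ltn_trans a0 am.
have m0 := ltnW m1; have zm := prim_expr_order zeta_prim.
have [xi xim] := exists_root_of (zeta ^+ a) m0.
rewrite dvdn_gcd dvdn_gcdl /=; split.
  move=> gen; apply/negP => /(halvable_mod a0)[t tE]; move: gen.
  exact: (cyclic_double_not_genuine G_gen g_order m1 zm w_def xim tE).
move=> /negP nd K Khopf /(twist_trivial_of_hopf Khopf)[F [Fi [FFi Etw]]].
apply: nd; have d0 : (0 < gcdn m (2 * a))%N by rewrite gcdn_gt0 m0.
have [n mE] := dvdnP (dvdn_gcdl m (2 * a)).
have n0 : (0 < n)%N by case: n mE m0 => // ->.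
have zn : zeta ^+ (2 * a * n) = 1.
  apply/eqP; rewrite -(prim_order_dvd zeta_prim) {1}mE mulnC.
  by rewrite dvdn_pmul2r // dvdn_gcdr.
have := cyclic_double_obstruction G_gen g_order m1 zm w_def xim FFi Etw zn.
move/eqP; rewrite -(prim_order_dvd zeta_prim) {1}mE mulnC.
by rewrite dvdn_pmul2r.
Qed.
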